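(* Let $\sigma\in S_n$ be written as a product of disjoint cycles $\sigma=\sigma_1\cdots\sigma_m$ (including cycles of length $1$), and let $i_k$ be the length of $\sigma_k$ (the size of the corresponding orbit of $\sigma$ on $\{1,\dots,n\}$). Then $$Tr_\sigma(Q_n^!,t)=\frac{1+t\displaystyle\prod_{k=1}^m\big(2-(-t)^{i_k}\big)}{1+t}.$$
   Context: Let $k$ be a field (of characteristic $0$). $Q_n^!$ is the quadratic dual of the associated graded algebra $\mathrm{gr}\,Q_n$, where $\mathrm{gr}\,Q_n$ is generated by $v_A$ ($\emptyset\ne A\subseteq\{1,\dots,n\}$) with relations $v_A(v_{A\setminus i}-v_{A\setminus j})=0$ for $|A|\ge2$, $i,j\in A$. Explicitly, $Q_n^!$ is the associative unital $k$-algebra with generators $s(A)$, $\emptyset\neq A\subseteq\{1,\dots,n\}$ ($s(A)$ dual to $v_A$), and relations: $s(A)\sum_{a\in A}s(A\setminus a)=0$ for $|A|\ge2$; and $s(A)s(B)=0$ if $B\not\subseteq A$ or $|B|\ne|A|-1$. (These imply $s(A)s(A\setminus i)s(A\setminus i\setminus j)=-s(A)s(A\setminus j)s(A\setminus i\setminus j)$.) It is graded by word length in the generators, $Q_n^!=\bigoplus_i(Q_n^!)_{[i]}$. $S_n$ acts by graded algebra automorphisms with $\sigma(s(A))=s(\sigma A)$, and $Tr_\sigma(Q_n^!,t)=\sum_{i\ge0}\mathrm{Tr}\big(\sigma|_{(Q_n^!)_{[i]}}\big)t^i$. *)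

(* Defs.v *)
From HB Require Import structures.
From mathcomp Require Import all_boot all_order all_fingroup all_algebra.
From mathcomp Require Import generic_quotient boolp.
From mathcomp Require Import monalg.

Set Implicit Arguments.
Unset Strict Implicit.
Unset Printing Implicit Defensive.

Import GRing.Theory.

Local Open Scope ring_scope.
Local Open Scope quotient_scope.

Section PowerSeries.
Variable k : fieldType.
Implicit Types f g : nat -> k.

(* A formal power series in t over k is its coefficient sequence nat -> k. *)

Definition psmul f g : nat -> k := fun d => \sum_(i < d.+1) f i * g (d - i)%N.

(* [:: b_0; ...; b_(d-1)], where sum_(i <= d) b_i g_(d-i) = [d = 0] *)
Fixpoint psinv_coefs g (d : nat) : seq k :=
  if d is d'.+1 then
    let s := psinv_coefs g d' in
    rcons s ((g 0)^-1 * ((d' == 0%N)%:R - \sum_(i < d') s`_i * g (d' - i)%N))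
  else [::].

Definition psinv g : nat -> k := fun d => (psinv_coefs g d.+1)`_d.

Definition psdiv f g : nat -> k := psmul f (psinv g).

Definition psof (p : {poly k}) : nat -> k := fun d => p`_d.

Lemma size_psinv_coefs g d : size (psinv_coefs g d) = d.
Proof. by elim: d => //= d IH; rewrite size_rcons IH. Qed.

Lemma nth_psinv_coefs g d i : (i < d)%N -> (psinv_coefs g d)`_i = psinv g i.
Proof.
elim: d => // d IH; rewrite ltnS leq_eqVlt => /orP[/eqP-> //|lt_id].
by rewrite -IH //= nth_rcons size_psinv_coefs lt_id.
Qed.

Lemma psinvP g : g 0%N != 0 -> forall d, psmul (psinv g) g d = (d == 0%N)%:R.
Proof.
move=> g0 d; rewrite /psmul big_ord_recr /= subnn.
rewrite /psinv /= nth_rcons size_psinv_coefs ltnn eqxx.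
rewrite mulrAC mulVf // mul1r.
under eq_bigr => i _ do rewrite -/(psinv g i) -(nth_psinv_coefs g (ltn_ord i)).
by rewrite addrC subrK.
Qed.

End PowerSeries.

Section Trace.
Variables (k : fieldType) (V : lmodType k).
Implicit Types (W : V -> Prop) (f : V -> V).

Definition lin_indep m (e : 'I_m -> V) : Prop :=
  forall c : 'I_m -> k, \sum_i c i *: e i = 0 -> forall i, c i = 0.

Definition basis_of_sub W m (e : 'I_m -> V) : Prop :=
  [/\ forall i, W (e i), lin_indep e
    & forall x, W x -> exists c : 'I_m -> k, x = \sum_i c i *: e i].

Definition is_trace f W (tau : k) : Prop :=
  exists m (e : 'I_m -> V) (M : 'M[k]_m),
    [/\ basis_of_sub W e, forall i, f (e i) = \sum_j M i j *: e j
      & tau = \tr M].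

(* The trace of the restriction of f to the finite-dimensional f-stable
   subspace W; for linear f it is computed in any basis (trace_onE), and a
   finite basis exists as soon as W is finitely spanned (span_basis).
   The default 0 is used only when W has no finite basis or is not f-stable. *)
Definition trace_on f W : k :=
  if pselect (exists tau, is_trace f W tau) is left h then sval (cid h) else 0.

Lemma lin_indep_eq m (e : 'I_m -> V) (c c' : 'I_m -> k) : lin_indep e ->
  \sum_i c i *: e i = \sum_i c' i *: e i -> c =1 c'.
Proof.
move=> le eq_c i; apply/eqP; rewrite -subr_eq0; apply/eqP.
apply: (le (fun i => c i - c' i)).
under eq_bigr do rewrite scalerBl.
by rewrite sumrB eq_c subrr.
Qed.

Lemma lincomb_mul m p q (A : 'M[k]_(m, p)) (B : 'M[k]_(p, q)) (e : 'I_q -> V) i :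
  \sum_j A i j *: (\sum_l B j l *: e l) = \sum_l (A *m B) i l *: e l.
Proof.
under eq_bigr do rewrite scaler_sumr.
rewrite exchange_big; apply: eq_bigr => l _; rewrite mxE scaler_suml.
by apply: eq_bigr => j _; rewrite scalerA.
Qed.

Lemma basis_change W m p (e : 'I_m -> V) (e' : 'I_p -> V) :
  basis_of_sub W e -> basis_of_sub W e' ->
  exists P : 'M[k]_(m, p), forall i, e i = \sum_j P i j *: e' j.
Proof.
move=> [We _ _] [_ _ spe].
have /choice[c cE] i : exists c : 'I_p -> k, e i = \sum_j c j *: e' j.
  exact/spe/We.
by exists (\matrix_(i, j) c i j) => i; rewrite cE; apply: eq_bigr => j _; rewrite mxE.
Qed.

Lemma lin_indep_mx m p (e : 'I_p -> V) (A B : 'M[k]_(m, p)) : lin_indep e ->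
  (forall i, \sum_j A i j *: e j = \sum_j B i j *: e j) -> A = B.
Proof.
by move=> le AB; apply/matrixP => i j; apply: (lin_indep_eq le (AB i)).
Qed.

Lemma basis_change_inv W m p (e : 'I_m -> V) (e' : 'I_p -> V)
    (P : 'M[k]_(m, p)) (P' : 'M[k]_(p, m)) :
    basis_of_sub W e -> (forall i, e i = \sum_j P i j *: e' j) ->
  (forall i, e' i = \sum_j P' i j *: e j) -> P *m P' = 1%:M.
Proof.
move=> [_ le _] PE P'E; apply: (lin_indep_mx le) => i.
rewrite -lincomb_mul; under eq_bigr do rewrite -P'E.
rewrite -PE (bigD1 i) //= mxE eqxx scale1r big1 ?addr0 // => j ne_ji.
by rewrite mxE eq_sym (negbTE ne_ji) scale0r.
Qed.

Lemma is_trace_uniq (f : {linear V -> V}) W tau tau' :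
  is_trace f W tau -> is_trace f W tau' -> tau = tau'.
Proof.
move=> [m [e [M [be fe ->]]]] [p [e' [M' [be' fe' ->]]]].
have [P PE] := basis_change be be'; have [P' P'E] := basis_change be' be.
have PP' := basis_change_inv be PE P'E.
have P'P := basis_change_inv be' P'E PE.
have MP : M *m P = P *m M'.
  case: be' => _ le' _; apply: (lin_indep_mx le') => i.
  rewrite -!lincomb_mul; under eq_bigr do rewrite -PE.
  rewrite -fe; under [RHS]eq_bigr do rewrite -fe'.
  by rewrite {1}PE linear_sum; apply: eq_bigr => j _; rewrite linearZ.
by rewrite -[M]mulmx1 -PP' mulmxA MP mxtrace_mulC mulmxA P'P mul1mx.
Qed.

Lemma trace_onE (f : {linear V -> V}) W m (e : 'I_m -> V) (M : 'M[k]_m) :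
  basis_of_sub W e -> (forall i, f (e i) = \sum_j M i j *: e j) ->
  trace_on f W = \tr M.
Proof.
move=> be fe; have trM : is_trace f W (\tr M) by exists m, e, M.
rewrite /trace_on; case: pselect => [h|[]]; last by exists (\tr M).
exact: is_trace_uniq (svalP (cid h)) trM.
Qed.

Lemma span_basis W (I : finType) (g : I -> V) :
    (forall x, W x <-> exists c : I -> k, x = \sum_i c i *: g i) ->
  exists m (e : 'I_m -> V), basis_of_sub W e.
Proof.
move=> WE.
pose indep (S : {set I}) := `[< forall c : I -> k,
  \sum_(i in S) c i *: g i = 0 -> forall i, i \in S -> c i = 0 >].
have ind0 : indep set0 by apply/asboolP => c _ i; rewrite inE.
have [S /maxsetP[/asboolP indS maxS] _] := maxset_exists ind0.
have gS j : exists c : I -> k, g j = \sum_(i in S) c i *: g i.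
  have [jS|jS] := boolP (j \in S).
    exists (fun i => (i == j)%:R).
    rewrite (bigD1 j) //= eqxx scale1r big1 ?addr0 // => i /andP[_ /negbTE->].
    by rewrite scale0r.
  have nind : ~ indep (j |: S).
    by move=> h; move: jS; rewrite -(maxS _ h (subsetU1 _ _)) setU11.
  apply: contrapT => ng; apply: nind; apply/asboolP => c c0.
  have cj0 : c j = 0.
    apply/eqP; apply: contrapT => /negP cj; apply: ng.
    exists (fun i => - (c j)^-1 * c i).
    under eq_bigr do rewrite -scalerA.
    move: c0; rewrite big_setU1 //= => /eqP; rewrite addrC addr_eq0 => /eqP c0.
    by rewrite -scaler_sumr c0 scalerN scaleNr opprK scalerA mulVf ?scale1r.
  move=> i; rewrite in_setU1 => /orP[/eqP->//|]; apply: indS.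
  by move: c0; rewrite big_setU1 //= cj0 scale0r add0r.
exists #|S|, (fun i => g (enum_val i)); split=> [i|c c0 i|x /WE[c ->]].
- apply/WE; exists (fun j => (j == enum_val i)%:R).
  rewrite (bigD1 (enum_val i)) //= eqxx scale1r big1 ?addr0 // => j /negbTE->.
  by rewrite scale0r.
- have iS := enum_valP i.
  pose c' j := c (enum_rank_in iS j).
  rewrite -(enum_valK_in iS i); apply: (indS c') => //.
  rewrite big_enum_val /= -[RHS]c0.
  by apply: eq_bigr => j _; rewrite /c' enum_valK_in.
have [d dE] := choice gS.
exists (fun i => \sum_j c j * d j (enum_val i)).
transitivity (\sum_(i in S) (\sum_j c j * d j i) *: g i); last first.
  by rewrite big_enum_val.
under [RHS]eq_bigr do rewrite scaler_suml.
rewrite exchange_big; apply: eq_bigr => j _.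
by rewrite {1}(dE j) scaler_sumr; apply: eq_bigr => i _; rewrite scalerA.
Qed.

End Trace.

Section QDual.
Variables (k : fieldType) (n : nat).

Definition letter : finType := {A : {set 'I_n} | A != set0}.

Definition freeQ := {malg k[{fmonom letter}]}.
HB.instance Definition _ := GRing.Lalgebra.on freeQ.

(* The letter A in the free algebra; fs set0 = 0 is a junk value, which the
   relations below never involve: A :\ a is nonempty as soon as |A| >= 2. *)
Definition fs (A : {set 'I_n}) : freeQ :=
  if insub A is Some l then << fmu (l : letter) >> else 0.

Inductive Qrel : freeQ -> Prop :=
| Qrel_sum (A : {set 'I_n}) of (2 <= #|A|)%N : Qrel (fs A * \sum_(a in A) fs (A :\ a))
| Qrel_mul (A B : {set 'I_n}) of A != set0 & B != set0
    & ~~ (B \subset A) || (#|B| != #|A| - 1)%N : Qrel (fs A * fs B).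

Inductive Qideal : freeQ -> Prop :=
| Qideal_rel x of Qrel x : Qideal x
| Qideal_0 : Qideal 0
| Qideal_add x y of Qideal x & Qideal y : Qideal (x + y)
| Qideal_mull x y of Qideal y : Qideal (x * y)
| Qideal_mulr x y of Qideal x : Qideal (x * y).

Definition Qideal_pred : {pred freeQ} := fun x => `[< Qideal x >].

Lemma Qideal_zmod_closed : zmod_closed Qideal_pred.
Proof.
split=> [|x y /asboolP Ix /asboolP Iy]; first exact/asboolP/Qideal_0.
apply/asboolP/Qideal_add => //.
by rewrite -mulN1r; apply: Qideal_mull.
Qed.

HB.instance Definition _ :=
  GRing.isZmodClosed.Build freeQ Qideal_pred Qideal_zmod_closed.

Definition Qdual : Type := Quotient.quot Qideal_pred.
HB.instance Definition _ := Choice.on Qdual.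
HB.instance Definition _ := Quotient.on Qdual.
HB.instance Definition _ := GRing.Zmodule.on Qdual.

Definition qpi (x : freeQ) : Qdual := \pi_Qdual x.

Lemma qpiK (x : Qdual) : qpi (repr x) = x.
Proof. exact: reprK. Qed.

Lemma qpiP x y : qpi x = qpi y <-> Qideal (x - y).
Proof.
rewrite /qpi; split=> [/eqP|Ixy]; first by rewrite -Quotient.idealrBE => /asboolP.
by apply/eqP; rewrite -Quotient.idealrBE; apply/asboolP.
Qed.

Lemma qpiD : {morph qpi : x y / x + y}.
Proof. by move=> x y; rewrite /qpi Quotient.pi_add. Qed.

Lemma qpi0 : qpi 0 = 0.
Proof. by apply: (addrI (qpi 0)); rewrite -qpiD !addr0. Qed.

Definition qone : Qdual := qpi 1.
Definition qmul (x y : Qdual) : Qdual := qpi (repr x * repr y).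
Definition qscale (c : k) (x : Qdual) : Qdual := qpi (c *: repr x).

Lemma repr_qpi x : Qideal (repr (qpi x) - x).
Proof. by apply/qpiP; rewrite qpiK. Qed.

Lemma qpiM x y : qpi (x * y) = qmul (qpi x) (qpi y).
Proof.
apply/esym/qpiP; set x' := repr _; set y' := repr _.
have -> : x' * y' - x * y = x' * (y' - y) + (x' - x) * y.
  by rewrite mulrBr mulrBl addrA subrK.
by apply: Qideal_add; [apply: Qideal_mull | apply: Qideal_mulr]; exact: repr_qpi.
Qed.

Lemma qpiZ c x : qpi (c *: x) = qscale c (qpi x).
Proof.
apply/esym/qpiP; rewrite -scalerBr -[_ - x]mul1r scalerAl.
exact/Qideal_mull/repr_qpi.
Qed.

Lemma qmulA : associative qmul.
Proof. by move=> x y z; rewrite -[x]qpiK -[y]qpiK -[z]qpiK -!qpiM mulrA. Qed.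
Lemma qmul1q : left_id qone qmul.
Proof. by move=> x; rewrite -[x]qpiK -qpiM mul1r. Qed.
Lemma qmulq1 : right_id qone qmul.
Proof. by move=> x; rewrite -[x]qpiK -qpiM mulr1. Qed.
Lemma qmulDl : left_distributive qmul +%R.
Proof.
by move=> x y z; rewrite -[x]qpiK -[y]qpiK -[z]qpiK -qpiD -!qpiM mulrDl qpiD.
Qed.
Lemma qmulDr : right_distributive qmul +%R.
Proof.
by move=> x y z; rewrite -[x]qpiK -[y]qpiK -[z]qpiK -qpiD -!qpiM mulrDr qpiD.
Qed.

Lemma fs_mcoeff1 (A : {set 'I_n}) : (fs A)@_(mone : {fmonom letter}) = 0.
Proof.
rewrite /fs; case: insub => [l|]; last by rewrite mcoeff0.
by rewrite mcoeffU fm1_eq1.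
Qed.

Lemma Qideal_mcoeff1 x : Qideal x -> x@_(mone : {fmonom letter}) = 0.
Proof.
elim=> {x} [x [A _|A B _ _ _]||x y _ x0 _ y0|x y _ y0|x y _ x0].
- by rewrite rmorphM /= fs_mcoeff1 mul0r.
- by rewrite rmorphM /= fs_mcoeff1 mul0r.
- exact: mcoeff0.
- by rewrite mcoeffD x0 y0 addr0.
- by rewrite rmorphM /= y0 mulr0.
- by rewrite rmorphM /= x0 mul0r.
Qed.

Lemma qone_neq0 : qone != 0.
Proof.
apply/eqP; rewrite -qpi0 => /qpiP; rewrite subr0 => /Qideal_mcoeff1 /eqP.
by rewrite mcoeffUU oner_eq0.
Qed.

HB.instance Definition _ := GRing.Zmodule_isNzRing.Build Qdual
  qmulA qmul1q qmulq1 qmulDl qmulDr qone_neq0.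

Lemma qscaleA a b x : qscale a (qscale b x) = qscale (a * b) x.
Proof. by rewrite -[x]qpiK -!qpiZ scalerA. Qed.
Lemma qscale1 : left_id 1 qscale.
Proof. by move=> x; rewrite -[x]qpiK -qpiZ scale1r. Qed.
Lemma qscaleDr : right_distributive qscale +%R.
Proof. by move=> a x y; rewrite -[x]qpiK -[y]qpiK -qpiD -!qpiZ scalerDr qpiD. Qed.
Lemma qscaleDl x : {morph qscale^~ x : a b / a + b}.
Proof. by move=> a b; rewrite -[x]qpiK -!qpiZ scalerDl qpiD. Qed.

HB.instance Definition _ := GRing.Zmodule_isLmodule.Build k Qdual
  qscaleA qscale1 qscaleDr qscaleDl.

Lemma qscaleAl c (x y : Qdual) : c *: (x * y) = (c *: x) * y.
Proof.
rewrite -[x]qpiK -[y]qpiK.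
have sE z : c *: qpi z = qpi (c *: z) by rewrite qpiZ.
have mE u v : qpi u * qpi v = qpi (u * v) by rewrite qpiM.
by rewrite mE !sE mE scalerAl.
Qed.

Lemma malg_scaleAr c (x y : freeQ) : c *: (x * y) = x * (c *: y).
Proof.
have cC : c%:MP * x = x * c%:MP.
  rewrite [x in LHS]monalgE [x in RHS]monalgE mulr_sumr mulr_suml.
  apply: eq_bigr => w _; rewrite !malgM_def !fgmulUU mul1m mulm1.
  by rewrite [c * _]mulrC.
by rewrite -!mul_malgC !mulrA cC.
Qed.

Lemma qscaleAr c (x y : Qdual) : c *: (x * y) = x * (c *: y).
Proof.
rewrite -[x]qpiK -[y]qpiK.
have sE z : c *: qpi z = qpi (c *: z) by rewrite qpiZ.
have mE u v : qpi u * qpi v = qpi (u * v) by rewrite qpiM.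
by rewrite mE !sE mE malg_scaleAr.
Qed.

HB.instance Definition _ := GRing.Lmodule_isLalgebra.Build k Qdual qscaleAl.
HB.instance Definition _ := GRing.Lalgebra_isAlgebra.Build k Qdual qscaleAr.

Lemma qpi_zmod_morphism : zmod_morphism qpi.
Proof.
move=> x y; apply: (addIr (qpi y)).
by rewrite -qpiD !subrK.
Qed.
Lemma qpi_monoid_morphism : monoid_morphism qpi.
Proof. by split=> // x y; rewrite qpiM. Qed.
Lemma qpi_scalable : scalable qpi.
Proof. by move=> c x; rewrite qpiZ. Qed.

HB.instance Definition _ := GRing.isZmodMorphism.Build freeQ Qdual qpi
  qpi_zmod_morphism.
HB.instance Definition _ := GRing.isMonoidMorphism.Build freeQ Qdual qpi
  qpi_monoid_morphism.
HB.instance Definition _ := GRing.isScalable.Build k freeQ Qdual *:%R qpi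
  qpi_scalable.

Lemma qpi_eq0 x : qpi x = 0 <-> Qideal x.
Proof. by rewrite -qpi0 qpiP subr0. Qed.

(* The generator s(A) of the presentation. *)
Definition qs (A : {set 'I_n}) : Qdual := qpi (fs A).

Lemma qs0 : qs set0 = 0.
Proof. by rewrite /qs /fs insubF ?eqxx // raddf0. Qed.

Lemma qs_sum (A : {set 'I_n}) : (2 <= #|A|)%N ->
  qs A * \sum_(a in A) qs (A :\ a) = 0.
Proof.
move=> A2; rewrite /qs -rmorph_sum -rmorphM.
exact/qpi_eq0/Qideal_rel/Qrel_sum.
Qed.

Lemma qs_mul (A B : {set 'I_n}) : A != set0 -> B != set0 ->
  ~~ (B \subset A) || (#|B| != #|A| - 1)%N -> qs A * qs B = 0.
Proof.
by move=> A0 B0 AB; rewrite /qs -rmorphM; apply/qpi_eq0/Qideal_rel/Qrel_mul.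
Qed.

Definition qword (w : seq letter) : Qdual := \prod_(A <- w) qs (val A).

Definition Qcomp (d : nat) (x : Qdual) : Prop :=
  exists c : d.-tuple letter -> k, x = \sum_w c w *: qword w.

Section Action.
Variable sigma : 'S_n.

Definition actword (w : {fmonom letter}) : Qdual :=
  \prod_(A <- w) qs (sigma @: val A).

Lemma actword_mmorphism : mmorphism actword.
Proof.
by split=> [u v|]; rewrite /actword ?fm1 ?big_nil // fmM big_cat.
Qed.
HB.instance Definition _ :=
  isMultiplicative.Build {fmonom letter} Qdual actword actword_mmorphism.

Definition actfree (x : freeQ) : Qdual := mmap (in_alg Qdual) actword x.

(* The automorphism of the quotient induced by actfree; see Qact_pi, Qact_qs. *)
Definition Qact (x : Qdual) : Qdual := actfree (repr x).

Lemma actfree_zmod_morphism : zmod_morphism actfree.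
Proof. exact: mmap_is_additive. Qed.
HB.instance Definition _ := GRing.isZmodMorphism.Build freeQ Qdual actfree
  actfree_zmod_morphism.

Lemma actfree_monoid_morphism : monoid_morphism actfree.
Proof.
have [] := @commr_mmap_is_multiplicative _ _ _ (in_alg Qdual) actword.
  by move=> g w w'; rewrite /GRing.comm /= mulr_algl mulr_algr.
by [].
Qed.
HB.instance Definition _ := GRing.isMonoidMorphism.Build freeQ Qdual actfree
  actfree_monoid_morphism.

Lemma actfreeZ : scalable actfree.
Proof.
move=> c x; rewrite /actfree.
by rewrite (@mmapZ _ _ _ (in_alg Qdual) actword) /= mulr_algl.
Qed.

Lemma actfree_fs A : actfree (fs A) = qs (sigma @: A).
Proof.
rewrite /fs; case: insubP => [l _ <-|].
  by rewrite /actfree mmapU /= scale1r mul1r /actword fmU big_seq1.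
by rewrite negbK => /eqP->; rewrite imset0 qs0 raddf0.
Qed.

Lemma actfree_ideal x : Qideal x -> actfree x = 0.
Proof.
elim=> {x} [x [A A2|A B A0 B0 AB]||x y _ x0 _ y0|x y _ y0|x y _ x0].
- rewrite rmorphM rmorph_sum /= actfree_fs -[RHS](@qs_sum (sigma @: A)).
    rewrite big_imset /=; last by move=> a b _ _ /perm_inj.
    congr (_ * _); apply: eq_bigr => a aA; rewrite actfree_fs; congr qs.
    apply/setP => b; rewrite !inE; apply/imsetP/idP => [[c]|/andP[ba /imsetP[c cA bE]]].
      rewrite !inE => /andP[ca cA] ->.
      by rewrite (inj_eq perm_inj) ca imset_f.
    by exists c => //; rewrite !inE cA andbT; apply: contraNneq ba => <-; apply/eqP.
  by rewrite card_imset //; apply: perm_inj.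
- rewrite rmorphM /= !actfree_fs qs_mul //.
  + by rewrite -card_gt0 card_imset ?card_gt0 //; apply: perm_inj.
  + by rewrite -card_gt0 card_imset ?card_gt0 //; apply: perm_inj.
  rewrite !card_imset //; try exact: perm_inj.
  case/orP: AB => [AB|->]; last by rewrite orbT.
  apply/orP; left; apply: contra AB => /subsetP AB; apply/subsetP => b bB.
  have /AB/imsetP[a aA /perm_inj->] : sigma b \in sigma @: B by apply: imset_f.
  by [].
- exact: raddf0.
- by rewrite raddfD /= x0 y0 addr0.
- by rewrite rmorphM /= y0 mulr0.
- by rewrite rmorphM /= x0 mul0r.
Qed.

Lemma Qact_pi x : Qact (qpi x) = actfree x.
Proof.
apply/eqP; rewrite -subr_eq0 /Qact -raddfB; apply/eqP.
exact/actfree_ideal/repr_qpi.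
Qed.

Lemma Qact_qs A : Qact (qs A) = qs (sigma @: A).
Proof. by rewrite /qs Qact_pi actfree_fs. Qed.

Lemma Qact_zmod_morphism : zmod_morphism Qact.
Proof.
by move=> x y; rewrite -[x]qpiK -[y]qpiK -raddfB !Qact_pi raddfB.
Qed.
Lemma Qact_monoid_morphism : monoid_morphism Qact.
Proof.
split=> [|x y]; first by rewrite -(rmorph1 qpi) Qact_pi !rmorph1.
by rewrite -[x]qpiK -[y]qpiK -rmorphM !Qact_pi rmorphM.
Qed.
Lemma Qact_scalable : scalable Qact.
Proof. by move=> c x; rewrite -[x]qpiK -linearZ !Qact_pi actfreeZ. Qed.

HB.instance Definition _ := GRing.isZmodMorphism.Build Qdual Qdual Qact
  Qact_zmod_morphism.
HB.instance Definition _ := GRing.isMonoidMorphism.Build Qdual Qdual Qact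
  Qact_monoid_morphism.
HB.instance Definition _ := GRing.isScalable.Build k Qdual Qdual *:%R Qact
  Qact_scalable.

Lemma Qcomp_word d (w : d.-tuple letter) : Qcomp d (qword w).
Proof.
exists (fun u => (u == w)%:R).
rewrite (bigD1 w) //= eqxx scale1r big1 ?addr0 // => u /negbTE->.
by rewrite scale0r.
Qed.

Lemma Qact_comp d x : Qcomp d x -> Qcomp d (Qact x).
Proof.
have imP (A : letter) : sigma @: val A != set0.
  by rewrite -card_gt0 card_imset ?card_gt0 ?(valP A) //; apply: perm_inj.
pose actl (A : letter) : letter := exist _ (sigma @: val A) (imP A).
have actlE (w : d.-tuple letter) : Qact (qword w) = qword (map_tuple actl w).
  rewrite /qword rmorph_prod /= big_map; apply: eq_bigr => A _.
  exact: Qact_qs.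
move=> [c ->]; rewrite linear_sum /=.
exists (fun w => \sum_(u | map_tuple actl u == w) c u).
under [RHS]eq_bigr do rewrite scaler_suml.
rewrite (partition_big (map_tuple actl) predT) //=.
apply: eq_bigr => w _; apply: eq_bigr => u /eqP <-.
by rewrite linearZ /= actlE.
Qed.

Lemma Qact_has_trace d : exists tau, is_trace Qact (Qcomp d) tau.
Proof.
have [m [e be]] := @span_basis k Qdual (Qcomp d) _ (fun w => qword (tval w))
  (fun x => iff_refl _).
have [We _ spe] := be.
have /choice[M ME] i : exists c : 'I_m -> k, Qact (e i) = \sum_j c j *: e j.
  exact/spe/Qact_comp/We.
exists (\tr (\matrix_(i, j) M i j)), m, e, (\matrix_(i, j) M i j).
by split=> // i; rewrite ME; apply: eq_bigr => j _; rewrite mxE.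
Qed.

(* Coefficient of t^d in Tr_sigma(Q_n^!, t). *)
Definition graded_trace (d : nat) : k := trace_on Qact (Qcomp d).

End Action.
End QDual.

(* Main.v *)
(* A nonzero word is s(A) s(A \ a_1) s(A \ {a_1, a_2}) ... and depends on the a_i
   only through a_1 /\ ... /\ a_p. The words of length p + 1 starting with s(A)
   span a copy of the quotient of the exterior power Lambda^p(k^A) by the multiples
   of e_A, the sum of the basis vectors; a representation of the algebra shows that
   there are no further relations. As e_A /\ _ is exact for nonempty A, the traces of
   sigma in degrees p + 1 and p add up, over the nonempty A with sigma A = A, to the
   traces of sigma on Lambda^p(k^A), i.e. to the signs of sigma on its invariant
   p-subsets B of A. This is (1 + t) Tr = 1 + t F, where expanding F, the product
   over the orbits C of 1 + (1 - (- t)^|C|), amounts to choosing B inside A: the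
   sign of sigma on the orbit C is - (- 1)^|C|. *)
From HB Require Import structures.
Require Import Defs.
From mathcomp Require Import all_boot all_order all_fingroup all_algebra.
From mathcomp Require Import ring generic_quotient monalg.

Set Implicit Arguments.
Unset Strict Implicit.
Unset Printing Implicit Defensive.

Import GRing.Theory.
Local Open Scope ring_scope.

(** * Signs of wedges and of permutations on invariant sets *)

Section Signs.
Variables (k : comNzRingType) (n : nat).
Implicit Types (A B C : {set 'I_n}) (a b c : 'I_n) (s : 'S_n) (J : {set {set 'I_n}}).

(* [sg a B] is the sign of a /\ b_1 /\ ... /\ b_p relative to the increasing
   wedge of a |: B, where b_1 < ... < b_p are the elements of B. *)
Definition sg a B : k := \prod_(b in B) (-1) ^+ (b < a).

(** The product over the inversions of s inside B: the sign of s b_1 /\ ... /\ s b_p relative to the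
    increasing wedge of s B, where b_1 < ... < b_p are the elements of B. *)
Definition inv_sign s B : k :=
  \prod_(i in B) \prod_(j in B) (-1) ^+ ((i < j) && (s j < s i))%N.

Lemma sg0 a : sg a set0 = 1.
Proof. exact: big_set0. Qed.

Lemma sg_sqr a B : sg a B * sg a B = 1.
Proof. by rewrite -big_split big1 // => b _; rewrite /= -expr2 sqrr_sign. Qed.

Lemma sgU1 a b B : b \notin B -> sg a (b |: B) = (-1) ^+ (b < a) * sg a B.
Proof. exact: big_setU1. Qed.

Lemma sgU a B C : [disjoint B & C] -> sg a (B :|: C) = sg a B * sg a C.
Proof. by move=> dBC; rewrite /sg -bigU //=; apply: eq_bigl => b; rewrite inE. Qed.

Lemma neq_sign a b : a != b -> (-1) ^+ (b < a) * (-1) ^+ (a < b) = -1 :> k.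
Proof.
by rewrite -val_eqE /=; case: ltngtP => // _ _; rewrite expr0 expr1 ?mulr1 ?mul1r.
Qed.

(** Both products compare a wedge with the increasing wedge of {a, b} and B, one starting with a /\
    b, the other with b /\ a. *)
Lemma sg_swap a b B : a != b -> a \notin B -> b \notin B ->
  sg a (b |: B) * sg b B = - (sg b (a |: B) * sg a B).
Proof.
move=> ab aB bB; rewrite !sgU1 //.
have: (-1) ^+ (b < a) = - (-1) ^+ (a < b) :> k.
  move: (neq_sign ab) => /(congr1 (fun x => x * (-1) ^+ (a < b))).
  by rewrite /= -mulrA -expr2 sqrr_sign mulr1 mulN1r.
by move=> ->; rewrite -!mulrA [sg a B * _]mulrC !mulNr.
Qed.

Lemma inv_sign0 s : inv_sign s set0 = 1.
Proof. exact: big_set0. Qed.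

(** Cocycle relation: s (a /\ B) = s a /\ s B, where a is moved into place before applying s and s a
    after it. *)
Lemma inv_signU1 s a B : a \notin B ->
  inv_sign s (a |: B) = inv_sign s B * (sg a B * sg (s a) (s @: B)).
Proof.
move=> aB; rewrite /inv_sign big_setU1 //= big_setU1 //= ltnn expr0 mul1r.
under [X in _ * X = _]eq_bigr => i _ do rewrite big_setU1 //=.
rewrite big_split /= [LHS]mulrA [LHS]mulrC; congr (_ * _).
rewrite -big_split /sg big_imset /=; last by move=> i j _ _; apply: perm_inj.
rewrite -big_split /=; apply: eq_bigr => b bB.
have ab : a != b by apply: contraNneq aB => ->.
have sab : s a != s b by rewrite (inj_eq perm_inj).
move: ab sab; rewrite -!val_eqE /=.
case: (ltngtP a b) => //= _ _; case: (ltngtP (s b) (s a)) => //= _ _;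
by rewrite ?expr0 ?expr1 ?mulr1 ?mul1r ?mulrNN ?mulr1.
Qed.

Lemma set_ind (P : {set 'I_n} -> Prop) : P set0 ->
  (forall a B, a \notin B -> P B -> P (a |: B)) -> forall B, P B.
Proof.
move=> P0 PU B; have [m] := ubnP #|B|; elim: m => // m IH in B *.
have [->//|[a aB]] := set_0Vmem B; rewrite (cardsD1 a) aB ltnS => leBm.
by rewrite -(setD1K aB); apply: PU; rewrite ?setD11 //; apply: IH.
Qed.

Lemma inv_sign_setU s B C : [disjoint B & C] ->
  inv_sign s (B :|: C) = inv_sign s B * inv_sign s C *
    \prod_(a in B) (sg a C * sg (s a) (s @: C)).
Proof.
elim/set_ind: B => [|a B aB IH]; first by rewrite set0U inv_sign0 big_set0 mul1r mulr1.
move=> dis; have aC : a \notin C by rewrite (disjointFr dis) ?setU11.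
have BC : [disjoint B & C] by apply: disjointWl dis; apply: subsetU1.
rewrite -setUA.
have sBC : [disjoint s @: B & s @: C].
  by rewrite imset_disjoint //; apply: perm_inj.
have aBC : a \notin B :|: C by rewrite inE negb_or aB.
rewrite !inv_signU1 // IH // big_setU1 //= imsetU !sgU //.
by ring.
Qed.

Lemma imset_traject s x j :
  s @: [set:: traject s x j] = [set:: traject s (s x) j].
Proof.
elim: j x => [|j IH] x /=; first by rewrite set_nil imset0.
by rewrite !set_cons imsetU1 IH.
Qed.

(* With u_i = s^i x and B_j = {u_0, ..., u_(j-1)}, the signs [sg u_j B_j]
   telescope in the product of the cocycle relations [inv_signU1]. *)
Lemma inv_sign_traject s x j : uniq (traject s x j.+1) ->
  inv_sign s [set:: traject s x j] =
  sg (iter j s x) [set:: traject s x j] *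
    \prod_(i < j) (-1) ^+ (x < iter i.+1 s x)%N.
Proof.
elim: j => [|j IH] Uj.
  have -> : [set:: traject s x 0] = set0 by apply/setP => y; rewrite !inE.
  by rewrite inv_sign0 sg0 big_ord0 mulr1.
have /andP[xT _] :
  (x \notin traject s (s x) j.+1) && uniq (traject s (s x) j.+1) := Uj.
move: Uj; rewrite [traject _ _ j.+2]trajectSr rcons_uniq => /andP[_ Uj].
have uT : iter j s x \notin traject s x j.
  by move: Uj; rewrite trajectSr rcons_uniq => /andP[].
have trajU : [set:: traject s x j.+1] = iter j s x |: [set:: traject s x j].
  by apply/setP => y; rewrite trajectSr !inE mem_rcons in_cons.
have trajI : [set:: traject s x j.+1] = x |: [set:: traject s (s x) j].
  by apply/setP => y; rewrite !inE.
have xsT : x \notin [set:: traject s (s x) j].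
  by move: xT; rewrite trajectSr mem_rcons in_cons negb_or inE => /andP[].
rewrite {1}trajU inv_signU1 ?inE // imset_traject IH // trajI sgU1 // big_ord_recr /=.
have sq := sg_sqr (iter j s x) [set:: traject s x j].
have sq2 : (-1) ^+ (x < iter j.+1 s x)%N * (-1) ^+ (x < iter j.+1 s x)%N = 1 :> k.
  by rewrite -expr2 sqrr_sign.
by ring: sq sq2.
Qed.

(** For an orbit of size j + 1, add the last element of the trajectory, whose image is x. Each of
    the j elements y other than x then contributes the signs of x < y and y < x, with product -1. *)
Lemma inv_sign_porbit s x : inv_sign s (porbit s x) = - (-1) ^+ #|porbit s x|.
Proof.
have := uniq_traject_porbit s x; have := iter_porbit s x.
have -> : inv_sign s (porbit s x) = inv_sign s [set:: traject s x #|porbit s x|].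
  by congr inv_sign; apply/setP => y; rewrite inE porbit_traject.
move: (card_porbit_neq0 s x); case: #|_| => // j _ itx Uj.
have uT : iter j s x \notin traject s x j.
  by move: Uj; rewrite trajectSr rcons_uniq => /andP[].
have trajU : [set:: traject s x j.+1] = iter j s x |: [set:: traject s x j].
  by apply/setP => y; rewrite trajectSr !inE mem_rcons in_cons.
have big_traject (F : 'I_n -> k) y i :
    \prod_(b <- traject s y i) F b = \prod_(l < i) F (iter l s y).
  elim: i y => [|i IH] y; first by rewrite big_nil big_ord0.
  by rewrite /= big_cons IH big_ord_recl; congr (_ * _); apply: eq_bigr => l _;
    rewrite -iterSr.
have /andP[xT UT] : (x \notin traject s (s x) j) && uniq (traject s (s x) j) := Uj.
have sgx : sg x [set:: traject s (s x) j] =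
    \prod_(l < j) (-1) ^+ (iter l.+1 s x < x)%N.
  under eq_bigr => l _ do rewrite iterSr.
  rewrite -(big_traject (fun b => (-1) ^+ (b < x)%N)) big_uniq //.
  by apply: eq_bigl => b; rewrite inE.
rewrite trajU inv_signU1 ?inE // inv_sign_traject // imset_traject.
rewrite [s _]itx sgx; have sq := sg_sqr (iter j s x) [set:: traject s x j].
transitivity (\prod_(l < j) ((-1) ^+ (x < iter l.+1 s x)%N *
                             (-1) ^+ (iter l.+1 s x < x)%N) : k).
  by rewrite big_split /=; ring: sq.
under eq_bigr => l _.
  rewrite neq_sign; first over.
  apply: contraNneq xT => E; apply/trajectP; exists l => //.
  by rewrite -iterSr E.
by rewrite prodr_const card_ord exprS mulN1r opprK.
Qed.



(** The cross terms of [inv_sign_setU] are squares of signs, since a and s a run over the same set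
    B. *)
Lemma inv_sign_invU s B C : [disjoint B & C] -> s @: B = B -> s @: C = C ->
  inv_sign s (B :|: C) = inv_sign s B * inv_sign s C.
Proof.
move=> dBC sB sC; rewrite inv_sign_setU // sC big_split /=.
have -> : \prod_(a in B) sg (s a) C = \prod_(a in B) sg a C.
  by rewrite -[in RHS]sB big_imset //; apply: in2W; apply: perm_inj.
by rewrite -big_split big1 ?mulr1 // => a _; rewrite /= sg_sqr.
Qed.

(** * Invariant sets as unions of orbits *)

Lemma mem_porbits s C x : C \in porbits s -> x \in C -> C = porbit s x.
Proof. by case/imsetP => y _ -> xy; apply/eqP; rewrite eq_sym eq_porbit_mem. Qed.

Lemma sub_inv_porbit s A x : s @: A = A -> x \in A -> porbit s x \subset A.
Proof.
move=> sA xA; apply/subsetP => y /porbitP[i ->].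
by elim: i => [|i IH]; rewrite ?perm1 // expgSr permM -sA imset_f.
Qed.

Lemma cover_porbits_inv s J : J \subset porbits s -> s @: cover J = cover J.
Proof.
move=> /subsetP sJ; apply/eqP; rewrite eqEcard card_imset ?leqnn ?andbT; last exact: perm_inj.
apply/subsetP => _ /imsetP[x /bigcupP[C CJ xC] ->]; apply/bigcupP; exists C => //.
by rewrite (mem_porbits (sJ _ CJ) xC) -[s]expg1 mem_porbit.
Qed.

Lemma inv_coverE s A : s @: A = A ->
  cover [set C in porbits s | C \subset A] = A.
Proof.
move=> sA; apply/setP => x; apply/bigcupP/idP => [[C]|xA].
  by rewrite inE => /andP[_ /subsetP CA] /CA.
exists (porbit s x); last exact: porbit_id.
by rewrite inE sub_inv_porbit // imset_f.
Qed.

Lemma porbits_coverE s J : J \subset porbits s ->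
  [set C in porbits s | C \subset cover J] = J.
Proof.
move=> /subsetP sJ; apply/setP => C; rewrite inE.
apply/andP/idP => [[Cs /subsetP CJ]|CJ]; last by rewrite sJ ?(bigcup_sup C).
have [x _ defC] := imsetP Cs.
have /CJ/bigcupP[D DJ xD] : x \in C by rewrite defC porbit_id.
by rewrite defC -(mem_porbits (sJ _ DJ) xD).
Qed.

Lemma inv_sign_cover s J : J \subset porbits s ->
  inv_sign s (cover J) = \prod_(C in J) (- (-1) ^+ #|C|).
Proof.
have [m] := ubnP #|J|; elim: m => // m IH in J *.
have [->|[C CJ]] := set_0Vmem J.
  by rewrite /cover !big_set0 inv_sign0.
rewrite (cardsD1 C) CJ ltnS => leJm sJ.
have sJC : J :\ C \subset porbits s by apply: subset_trans sJ; apply: subsetDl.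
have Cs : C \in porbits s := subsetP sJ C CJ.
have coverC : cover [set C] = C by rewrite /cover big_set1.
have -> : cover J = C :|: cover (J :\ C) by rewrite /cover (big_setD1 C).
rewrite inv_sign_invU ?IH ?(cover_porbits_inv sJC) //.
- rewrite [RHS](big_setD1 C) //=; congr (_ * _).
  by have [x _ ->] := imsetP Cs; apply: inv_sign_porbit.
- rewrite -setI_eq0; apply/eqP/setP => x; rewrite !inE.
  apply/andP => -[xC /bigcupP[D /setD1P[DC DJ] xD]].
  by case/eqP: DC; rewrite (mem_porbits Cs xC); apply: mem_porbits => //; apply: (subsetP sJ).
by rewrite -coverC cover_porbits_inv // sub1set.
Qed.

Lemma prod_add1_powerset (I : finType) (P : {set I}) (R : comNzRingType) (F : I -> R) :
  \prod_(i in P) (1 + F i) = \sum_(J : {set I} | J \subset P) \prod_(i in J) F i.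
Proof.
pose G i := if i \in P then F i else 0.
transitivity (\prod_i (G i + 1)).
  by rewrite big_mkcond; apply: eq_bigr => i _; rewrite /G; case: ifP; rewrite ?add0r // addrC.
rewrite bigA_distr [RHS]big_mkcond; apply: eq_bigr => J _; rewrite -big_mkcond /=.
case: ifP => [/subsetP JP|/negbT/subsetPn[i iJ iP]].
  by apply: eq_bigr => i /JP iP; rewrite /G iP.
by rewrite (bigD1 i) //= /G (negbTE iP) mul0r.
Qed.

(** With F C = - (- 'X)^|C| each factor is 1 + (1 + F C). The first expansion chooses the orbits
    that make up A, the second chooses among these the orbits of B. *)
Lemma prod_porbits s :
  \prod_(C in porbits s) (2%:R - (- 'X) ^+ #|C|) =
  \sum_(A : {set 'I_n} | s @: A == A)
     \sum_(B : {set 'I_n} | (s @: B == B) && (B \subset A))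
       (inv_sign s B)%:P * 'X^#|B| :> {poly k}.
Proof.
pose F (C : {set 'I_n}) : {poly k} := - (- 'X) ^+ #|C|.
under eq_bigr => C _ do rewrite -[2%:R]/(1 + 1) -addrA -/(F C).
rewrite prod_add1_powerset.
rewrite (reindex_onto cover (fun A => [set C in porbits s | C \subset A])) /=; last first.
  by move=> A /eqP; apply: inv_coverE.
apply: eq_big => J.
  apply/idP/andP => [sJ|[_ /eqP <-]].
    by rewrite cover_porbits_inv // porbits_coverE // !eqxx.
  by apply/subsetP => C; rewrite inE => /andP[].
move=> sJ; rewrite prod_add1_powerset.
rewrite (reindex_onto cover (fun A => [set C in porbits s | C \subset A])) /=; last first.
  by move=> A /andP[/eqP sA _]; apply: inv_coverE.
apply: eq_big => J'.
  apply/idP/idP => [sJ'|/andP[/andP[_ sJ'] /eqP <-]].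
    have sP := subset_trans sJ' sJ.
    rewrite cover_porbits_inv // porbits_coverE // !eqxx andbT /=.
    by apply/bigcupsP => C CJ'; apply: bigcup_sup; apply: (subsetP sJ').
  apply: subset_trans (_ : [set C in porbits s | C \subset cover J] \subset J); last first.
    by rewrite porbits_coverE.
  by apply/subsetP => C; rewrite !inE => /andP[-> CJ]; apply: subset_trans sJ'.
move=> sJ'; have sP := subset_trans sJ' sJ.
rewrite inv_sign_cover //.
have -> : #|cover J'| = (\sum_(C in J') #|C|)%N.
  apply/esym/eqP; apply/trivIsetP => C D CJ' DJ'; apply: contraR.
  case/pred0Pn => x /= /andP[xC xD]; apply/eqP.
  by rewrite (mem_porbits (subsetP sP _ CJ') xC) (mem_porbits (subsetP sP _ DJ') xD).
rewrite rmorph_prod /= -prodrXr -big_split /=; apply: eq_bigr => C _.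
by rewrite /F [in LHS]exprNn polyCN rmorphXn /= polyCN mulNr.
Qed.

End Signs.

(** * Power series and traces *)

Section PowerSeriesQuotient.
Variable k : fieldType.

(** The coefficients w of the inverse of 1 + 'X satisfy w_0 = 1 and w_(j+1) = - w_j, so the
    convolution of f with w obeys the recursion of h. *)
Lemma psdiv_1X (f h : nat -> k) : h 0 = f 0 ->
  (forall d, h d.+1 + h d = f d.+1) -> forall d, h d = psdiv f (psof (1 + 'X)) d.
Proof.
move=> h0 hS d; set g := psof _.
have gE j : g j = (j <= 1)%:R.
  rewrite /g /psof coefD coef1 coefX.
  by case: j => [|[]] //=; rewrite ?addr0 ?add0r.
have g0 : g 0 != 0 by rewrite gE oner_eq0.
have invS j : psinv g j.+1 = - psinv g j.
  have := psinvP g0 j.+1; rewrite /psmul !big_ord_recr /= subnn subSnn !gE !mulr1.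
  rewrite big1 ?add0r => [/eqP|i _]; first by rewrite addrC addr_eq0 => /eqP.
  by rewrite gE subSn ?(ltnW (ltn_ord i)) // ltnS leqn0 subn_eq0 leqNgt ltn_ord mulr0.
have inv0 : psinv g 0 = 1.
  by have := psinvP g0 0; rewrite /psmul big_ord1 gE mulr1.
rewrite /psdiv /psmul; move: (psinv g) invS inv0 => w invS inv0.
elim: d => [|d IH]; first by rewrite big_ord1 inv0 mulr1.
rewrite big_ord_recr /= subnn inv0 mulr1 -hS IH [RHS]addrC -addrA -big_split /=.
rewrite big1 ?addr0 // => i _.
by rewrite (subSn (ltn_ord i : (i <= d)%N)) invS mulrN subrr.
Qed.

End PowerSeriesQuotient.

(** * Traces on a span whose relations are given by an idempotent *)

Section IdempotentTrace.
Variables (k : fieldType) (V : lmodType k).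

(* If the linear relations between the g_i form the left kernel of an idempotent
   Pi, then the combinations of the g_i given by a basis of the row space of Pi
   are a basis of W. *)
Lemma trace_on_idem W (f : {linear V -> V}) N (g : 'I_N -> V) (S Pi : 'M[k]_N) :
    (forall x, W x <-> exists c : 'rV[k]_N, x = \sum_i c 0 i *: g i) ->
    (forall i, f (g i) = \sum_j S i j *: g j) -> Pi *m Pi = Pi ->
    (forall c : 'rV[k]_N, \sum_i c 0 i *: g i = 0 <-> c *m Pi = 0) ->
  trace_on f W = \tr (S *m Pi).
Proof.
move=> WE fg PiPi kerg; pose B := row_base Pi.
have [D BE] : exists D, B = D *m Pi by apply/submxP; rewrite eq_row_base.
have [C PiE] : exists C, Pi = C *m B by apply/submxP; rewrite eq_row_base.
have BPi : B *m Pi = B by rewrite BE -mulmxA PiPi.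
have BC : B *m C = 1%:M.
  by apply: (row_free_inj (row_base_free Pi)); rewrite /= -mulmxA -PiE mul1mx.
pose e i := \sum_j B i j *: g j.
have rowE (A : 'M[k]_(\rank Pi, N)) i : \sum_j A i j *: g j = \sum_j row i A 0 j *: g j.
  by apply: eq_bigr => j _; rewrite mxE.
have comb (c : 'rV[k]_(\rank Pi)) : \sum_i c 0 i *: e i = \sum_j (c *m B) 0 j *: g j.
  exact: lincomb_mul.
have be : basis_of_sub W e.
  split=> [i|c c0 i|x /WE[c ->]].
  - by apply/WE; exists (row i B); apply: rowE.
  - have /kerg : \sum_j (\row_i c i *m B) 0 j *: g j = 0.
      by rewrite -comb -[RHS]c0; apply: eq_bigr => j _; rewrite mxE.
    rewrite -mulmxA BPi => /eqP; rewrite (mulmx_free_eq0 _ (row_base_free Pi)).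
    by move=> /eqP/rowP/(_ i); rewrite !mxE.
  - exists (fun i => (c *m C) 0 i); rewrite comb -mulmxA -PiE.
    apply/eqP; rewrite -subr_eq0 -sumrB.
    under eq_bigr => i _ do rewrite -scalerBl.
    have /kerg E : (c - c *m Pi) *m Pi = 0 by rewrite mulmxBl -mulmxA PiPi subrr.
    by apply/eqP; rewrite -[RHS]E; apply: eq_bigr => i _; rewrite !mxE.
(* In the basis e the map f has matrix B S C; by cyclicity its trace is that of S C B = S Pi. *)
rewrite (@trace_onE _ _ f W _ e (B *m S *m C)) //.
  by rewrite mxtrace_mulC mulmxA -PiE mxtrace_mulC.
move=> i; rewrite /e linear_sum.
under eq_bigr => j _ do rewrite linearZ /= fg.
rewrite lincomb_mul lincomb_mul; apply/eqP; rewrite -subr_eq0 -sumrB.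
under eq_bigr => j _ do rewrite -scalerBl.
have /kerg E : (row i (B *m S) - row i (B *m S *m C *m B)) *m Pi = 0.
  rewrite mulmxBl -!row_mul -(mulmxA _ B Pi) BPi -(mulmxA _ C B) -PiE.
  by rewrite subrr.
by apply/eqP; rewrite -[RHS]E; apply: eq_bigr => j _; rewrite !mxE.
Qed.

End IdempotentTrace.

Lemma mxtrace_shift (k : fieldType) m (I S E P P' : 'M[k]_m) :
  S *m E = E *m S -> P *m E = E *m P' ->
  \tr (S *m (P *m (E *m I))) = \tr (S *m (P' *m (I *m E))).
Proof.
move=> SE PE; rewrite (mulmxA P) PE -(mulmxA E) (mulmxA S) SE -(mulmxA E).
by rewrite mxtrace_mulC -!mulmxA.
Qed.

Lemma mulmx_annihD (k : fieldType) m (E I P : 'M[k]_m) :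
  P *m I = 0 -> P *m (E *m I + I *m E) = P *m (E *m I).
Proof. by move=> PI; rewrite mulmxDr (mulmxA P I) PI mul0mx addr0. Qed.

(** * Matrices indexed by a finite type and given by kernels *)

Section Kernels.
Variables (k : fieldType) (T : finType) (x0 : T).
(** Equal to #|T| because T has the element [x0]; the successor form makes the square matrices of
    this size a nonzero algebra, the target of the representation below. *)
Local Notation N := #|T|.-1.+1.

Lemma prednK_card : N = #|T|.
Proof. by rewrite prednK // -cardsT card_gt0; apply/set0Pn; exists x0. Qed.

Definition ev (i : 'I_N) : T := enum_val (cast_ord prednK_card i).
Definition rk (x : T) : 'I_N := cast_ord (esym prednK_card) (enum_rank x).

Lemma rkK : cancel rk ev.
Proof. by move=> x; rewrite /ev /rk cast_ordKV enum_rankK. Qed.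

Lemma evK : cancel ev rk.
Proof. by move=> i; rewrite /ev /rk enum_valK cast_ordK. Qed.

Lemma sum_ev (V : nmodType) (F : T -> V) : \sum_i F (ev i) = \sum_x F x.
Proof.
by rewrite [RHS](reindex ev) //; exists rk => x _; rewrite ?evK ?rkK.
Qed.

Definition kmx (F : T -> T -> k) : 'M[k]_N := \matrix_(i, j) F (ev i) (ev j).
Definition kcol (u : T -> k) : 'cV[k]_N := \col_i u (ev i).

(** The values lie in any module: scalars give the product with a column ([kmx_col]), and the family
    of chains gives linear combinations inside the algebra. *)
Definition kact (V : lmodType k) (F : T -> T -> k) (u : T -> V) : T -> V :=
  fun x => \sum_y F x y *: u y.

Lemma kmx_col F u : kmx F *m kcol u = kcol (kact F (u : T -> k^o)).
Proof.
apply/matrixP => i j; rewrite !mxE /kact -sum_ev.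
by apply: eq_bigr => l _; rewrite !mxE.
Qed.

Lemma eq_kcol u v : u =1 v -> kcol u = kcol v.
Proof. by move=> uv; apply/matrixP => i j; rewrite !mxE. Qed.

Lemma eq_mx_kcol (M M' : 'M[k]_N) :
  (forall u, M *m kcol u = M' *m kcol u) -> M = M'.
Proof.
move=> MM'; apply/matrixP => i j.
have delta (A : 'M[k]_N) : (A *m kcol (fun x => (x == ev j)%:R)) i 0 = A i j.
  rewrite mxE (bigD1 j) //= mxE eqxx mulr1 big1 ?addr0 // => l lj.
  by rewrite mxE (inj_eq (can_inj evK)) (negbTE lj) mulr0.
by rewrite -!delta MM'.
Qed.

Lemma sum_kmx (V : lmodType k) F (u : T -> V) i :
  \sum_j kmx F i j *: u (ev j) = kact F u (ev i).
Proof. by rewrite /kact -sum_ev; apply: eq_bigr => j _; rewrite mxE. Qed.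

Lemma tr_kmx F : \tr (kmx F) = \sum_x F x x.
Proof. by rewrite /mxtrace -sum_ev; apply: eq_bigr => i _; rewrite mxE. Qed.

Definition kern (I : finType) (P : T -> pred I) (c : T -> I -> k) (phi : T -> I -> T) :
  T -> T -> k := fun x y => \sum_(a | P x a) c x a * (y == phi x a)%:R.

Lemma kact_kern (V : lmodType k) (I : finType) P c phi (u : T -> V) x :
  kact (@kern I P c phi) u x = \sum_(a | P x a) c x a *: u (phi x a).
Proof.
rewrite /kact /kern; under eq_bigr => y _ do rewrite scaler_suml.
rewrite exchange_big; apply: eq_bigr => a _ /=.
rewrite (bigD1 (phi x a)) //= eqxx mulr1 big1 ?addr0 // => y /negbTE->.
by rewrite mulr0 scale0r.
Qed.

Definition monkern (c : T -> k) (phi : T -> T) : T -> T -> k :=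
  fun x y => c x * (y == phi x)%:R.

Lemma kact_monkern (V : lmodType k) c phi (u : T -> V) x :
  kact (monkern c phi) u x = c x *: u (phi x).
Proof.
rewrite /kact /monkern (bigD1 (phi x)) //= eqxx mulr1 big1 ?addr0 // => y /negbTE->.
by rewrite mulr0 scale0r.
Qed.

End Kernels.

(** * Chains of sets in the algebra *)

Section Chains.
Variables (k : fieldType) (n : nat) (Q : algType k) (qs : {set 'I_n} -> Q).
Hypothesis qs0 : qs set0 = 0.
Hypothesis qs_sum : forall A : {set 'I_n}, (2 <= #|A|)%N ->
  qs A * \sum_(a in A) qs (A :\ a) = 0.
Hypothesis qs_mul : forall A B : {set 'I_n}, A != set0 -> B != set0 ->
  ~~ (B \subset A) || (#|B| != #|A| - 1)%N -> qs A * qs B = 0.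
Local Notation sg := (@sg k n).
Local Notation T := ({set 'I_n} * {set 'I_n})%type.
Implicit Types (A B C : {set 'I_n}) (a b c : 'I_n) (s : 'S_n).

Lemma setD1C A a b : A :\ a :\ b = A :\ b :\ a.
Proof. by rewrite !setDDl setUC. Qed.

Lemma setU1D1 B a b : a != b -> (a |: B) :\ b = a |: B :\ b.
Proof.
move=> ab; apply/setP => c; rewrite !inE.
by case: (eqVneq c a) => [->|]; rewrite ?ab.
Qed.

Lemma imsetD1 s A a : s @: (A :\ a) = (s @: A) :\ s a.
Proof.
apply/setP => b; rewrite -[b](permKV s) !inE !(mem_imset _ _ (@perm_inj _ s)).
by rewrite !inE (inj_eq perm_inj).
Qed.

(** Multiply the sum relation for A by s(A \ {b, c}) on the right: A \ {b, c} lies in A \ a only for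
    a = b and a = c, so two terms survive. *)
Lemma qs_anti A b c : b != c -> b \in A -> c \in A ->
  qs A * (qs (A :\ b) * qs (A :\ b :\ c)) =
  - (qs A * (qs (A :\ c) * qs (A :\ c :\ b))).
Proof.
move=> bc bA cA; rewrite [A :\ c :\ b]setD1C.
(* For A = {b, c} both sides contain the default value [qs set0], which is 0. *)
have [->|C0] := eqVneq (A :\ b :\ c) set0; first by rewrite qs0 !mulr0 oppr0.
have A2 : (2 <= #|A|)%N.
  by rewrite (cardsD1 b) bA (cardsD1 c) !inE eq_sym bc cA.
have := congr1 ( *%R^~ (qs (A :\ b :\ c))) (qs_sum A2).
rewrite /= mul0r -mulrA mulr_suml (bigD1 b) //= (bigD1 c) 1?eq_sym ?bc ?cA //=.
rewrite big1 ?addr0 => [|a /andP[/andP[aA ab] ac]].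
  by rewrite mulrDr => /eqP; rewrite addr_eq0 => /eqP.
apply: qs_mul => //; first by apply/set0Pn; exists b; rewrite !inE eq_sym ab.
by apply/orP; left; apply/subsetPn; exists a; rewrite !inE ?eqxx // ac ab.
Qed.

(* s(A) s(A \ b_1) ... s(A \ {b_1, ..., b_p}) for an enumeration b of B, signed
   so as not to depend on b (see [qs_chain]); the class of b_1 /\ ... /\ b_p. *)
Fixpoint chain_rec p A B : Q :=
  if p is p'.+1 then
    if [pick b in B] is Some b then
      sg b (B :\ b) *: (qs A * chain_rec p' (A :\ b) (B :\ b))
    else 0
  else qs A.

Lemma chain_recS p A B b : b \in B -> exists2 c, c \in B &
  chain_rec p.+1 A B = sg c (B :\ c) *: (qs A * chain_rec p (A :\ c) (B :\ c)).
Proof. by move=> bB /=; case: pickP => [c|/(_ b)/=]; [exists c | rewrite bB]. Qed.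

Lemma chain_rec_head p A B : exists x, chain_rec p A B = qs A * x.
Proof.
case: p => [|p] /=; first by exists 1; rewrite mulr1.
case: pickP => [b _|_]; last by exists 0; rewrite mulr0.
by exists (sg b (B :\ b) *: chain_rec p (A :\ b) (B :\ b)); rewrite scalerAr.
Qed.

Lemma sg_swapD B b c : b != c -> b \in B -> c \in B ->
  sg b (B :\ b) * sg c (B :\ b :\ c) = - (sg c (B :\ c) * sg b (B :\ b :\ c)).
Proof.
move=> bc bB cB; have := @sg_swap k n b c (B :\ b :\ c) bc.
have -> : b |: B :\ b :\ c = B :\ c by rewrite setD1C setD1K // !inE bc.
have -> : c |: B :\ b :\ c = B :\ b by rewrite setD1K // !inE eq_sym bc.
by apply; rewrite !inE ?eqxx ?andbF.
Qed.

(** The element c picked by [chain_rec] may differ from b. By induction the two tails may be taken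
    to remove c after b and b after c; [qs_anti] and [sg_swapD] then change sign together. *)
Lemma qs_chain_rec p A B b : #|B| = p.+1 -> B \subset A -> b \in B ->
  qs A * chain_rec p (A :\ b) (B :\ b) = sg b (B :\ b) *: chain_rec p.+1 A B.
Proof.
elim: p A B b => [|p IH] A B b cB /subsetP sBA bB.
  have [c cB' ->] := chain_recS 0 A bB.
  have [<-|bc] := eqVneq b c; first by rewrite scalerA sg_sqr scale1r.
  by move: cB; rewrite (cardsD1 b) bB (cardsD1 c) !inE eq_sym bc cB'.
have [c cB' ->] := chain_recS p.+1 A bB.
have [<-|bc] := eqVneq b c; first by rewrite scalerA sg_sqr scale1r.
have cD a : a \in B -> #|B :\ a| = p.+1.
  by move=> aB; move: cB; rewrite (cardsD1 a) aB => -[].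
have chainD a a' : a' != a -> a \in B -> a' \in B ->
    chain_rec p.+1 (A :\ a) (B :\ a) =
    sg a' (B :\ a :\ a') *: (qs (A :\ a) * chain_rec p (A :\ a :\ a') (B :\ a :\ a')).
  move=> aa' aB a'B; rewrite IH ?cD //; last by rewrite !inE aa'.
    by rewrite scalerA sg_sqr scale1r.
  by apply: setSD; apply/subsetP.
have cb : c != b by rewrite eq_sym.
rewrite (chainD b c) // (chainD c b) //.
have [x xE] := chain_rec_head p (A :\ b :\ c) (B :\ b :\ c).
rewrite -!scalerAr !scalerA [B :\ c :\ b]setD1C [A :\ c :\ b]setD1C xE.
have := qs_anti bc (sBA _ bB) (sBA _ cB'); rewrite [A :\ c :\ b]setD1C => anti.
have mA y z t : qs y * (qs z * (qs t * x)) = qs y * (qs z * qs t) * x by rewrite !mulrA.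
rewrite !mA anti mulNr scalerN -scaleNr; congr (_ *: _).
have e1 := sg_swapD bc bB cB'.
by rewrite -mulrA -[sg c (B :\ c) * _]opprK -e1 mulrN mulrA sg_sqr mul1r.
Qed.

(** Extended by 0 to all pairs, so that the index set is that of the matrices below. *)
Definition chain (x : T) : Q :=
  if x.2 \subset x.1 then chain_rec #|x.2| x.1 x.2 else 0.

Lemma chain0 A : chain (A, set0) = qs A.
Proof. by rewrite /chain sub0set cards0. Qed.

Lemma chain_nsub A B : (B \subset A) = false -> chain (A, B) = 0.
Proof. by rewrite /chain /= => ->. Qed.

Lemma qs_chain A B b : B \subset A -> b \in B ->
  qs A * chain (A :\ b, B :\ b) = sg b (B :\ b) *: chain (A, B).
Proof.
move=> sBA bB; rewrite /chain /= setSD // sBA.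
have cB : #|B| = #|B :\ b|.+1 by rewrite (cardsD1 b B) bB.
by rewrite cB qs_chain_rec.
Qed.

Lemma chainE A B b : B \subset A -> b \in B ->
  chain (A, B) = sg b (B :\ b) *: (qs A * chain (A :\ b, B :\ b)).
Proof. by move=> sBA bB; rewrite qs_chain // scalerA sg_sqr scale1r. Qed.

Lemma chain_ind (P : {set 'I_n} -> {set 'I_n} -> Prop) :
    (forall A, P A set0) ->
    (forall A B b, B \subset A -> b \in B -> P (A :\ b) (B :\ b) -> P A B) ->
  forall A B, B \subset A -> P A B.
Proof.
move=> P0 PD A B; have [m] := ubnP #|B|; elim: m => // m IH in A B *.
have [->//|[b bB]] := set_0Vmem B; rewrite (cardsD1 b) bB ltnS => leB sBA.
by apply: (PD _ _ b) => //; apply: IH => //; apply: setSD.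
Qed.

Lemma chain_head A B : exists x, chain (A, B) = qs A * x.
Proof.
rewrite /chain; case: ifP => _; last by exists 0; rewrite mulr0.
exact: chain_rec_head.
Qed.

Lemma chain_set0 B : chain (set0, B) = 0.
Proof. by have [x ->] := chain_head set0 B; rewrite qs0 mul0r. Qed.

Lemma qs_sum_all A : qs A * \sum_(a in A) qs (A :\ a) = 0.
Proof.
have [A2|A1] := leqP 2 #|A|; first exact: qs_sum.
rewrite big1 ?mulr0 // => a aA; suff -> : A :\ a = set0 by [].
by apply/eqP; rewrite -cards_eq0 -leqn0 -ltnS; move: A1; rewrite (cardsD1 a) aA.
Qed.

(* e_A /\ (b_1 /\ ... /\ b_p) = 0, where e_A is the sum of the elements of A. *)
Lemma chain_rel A B : B \subset A ->
  \sum_(a in A :\: B) sg a B *: chain (A, a |: B) = 0.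
Proof.
move: A B; apply: chain_ind => [A|A B b sBA bB IH].
  rewrite setD0 -[RHS](qs_sum_all A) mulr_sumr; apply: eq_bigr => a aA.
  rewrite (@chainE _ _ a) ?setU11 //; last by rewrite setU0 sub1set.
  have -> : (a |: set0) :\ a = set0 by rewrite setU0 setDv.
  by rewrite chain0 sg0 !scale1r.
have DD : (A :\ b) :\: (B :\ b) = A :\: B.
  by apply/setP => a; rewrite !inE; have [->|//] := eqVneq a b; rewrite bB andbF.
(* Move b in front of a, which costs a sign, and factor s(A) out: what remains is the relation for A
   \ b and B \ b. *)
transitivity (\sum_(a in A :\: B) (- sg b (B :\ b)) *:
    (qs A * (sg a (B :\ b) *: chain (A :\ b, a |: (B :\ b))))); last first.
  by rewrite -scaler_sumr -mulr_sumr -DD IH mulr0 scaler0.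
apply: eq_bigr => a; rewrite inE => /andP[aB aA].
have ab : a != b by apply: contraNneq aB => ->.
rewrite (@chainE A (a |: B) b) ?setU1D1 ?inE ?bB ?orbT //; last first.
  by rewrite subUset sub1set aA.
rewrite -scalerAr !scalerA; congr (_ *: _).
have := @sg_swap k n a b (B :\ b) ab; rewrite setD1K // !inE eqxx (negbTE aB) andbF.
move=> /(_ isT isT) e1.
rewrite -[sg a B]mulr1 -(sg_sqr k b (B :\ b)) [sg a B * _]mulrA e1.
by have q2 := sg_sqr k b (a |: B :\ b); ring: q2.
Qed.

(** The image is the chain along the enumeration s b_1, ..., s b_p of s B; [inv_signU1] accounts for
    the change of sign at each step. *)
Lemma chain_morph s (f : Q -> Q) : scalable f -> {morph f : x y / x * y} ->
    (forall A, f (qs A) = qs (s @: A)) ->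
  forall A B, B \subset A ->
    f (chain (A, B)) = inv_sign k s B *: chain (s @: A, s @: B).
Proof.
move=> fZ fM fqs; apply: chain_ind => [A|A B b sBA bB IH].
  by rewrite imset0 !chain0 fqs inv_sign0 scale1r.
rewrite (chainE sBA bB) fZ fM fqs IH !imsetD1 -scalerAr.
rewrite qs_chain ?imsetS ?imset_f // !scalerA; congr (_ *: _).
have -> : inv_sign k s B =
    inv_sign k s (B :\ b) * (sg b (B :\ b) * sg (s b) (s @: B :\ s b)).
  by rewrite -imsetD1 -inv_signU1 ?setD11 // setD1K.
have sq := sg_sqr k b (B :\ b); ring: sq.
Qed.

(** * Words and chains span the same components *)

Definition spans (I : finType) (g : I -> Q) (x : Q) : Prop :=
  exists c : I -> k, x = \sum_i c i *: g i.

Lemma spans_gen (I : finType) (g : I -> Q) i : spans g (g i).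
Proof.
exists (fun j => (j == i)%:R); rewrite (bigD1 i) //= eqxx scale1r big1 ?addr0 //.
by move=> j /negbTE ->; rewrite scale0r.
Qed.

Lemma spansZ (I : finType) (g : I -> Q) (c : k) x : spans g x -> spans g (c *: x).
Proof.
move=> [d ->]; exists (fun i => c * d i).
by rewrite scaler_sumr; apply: eq_bigr => i _; rewrite scalerA.
Qed.

Lemma spans0 (I : finType) (g : I -> Q) : spans g 0.
Proof. by exists (fun=> 0); rewrite big1 // => i _; rewrite scale0r. Qed.

Lemma spans_sum (I J : finType) (g : I -> Q) (h : J -> Q) (c : J -> k) :
  (forall j, spans g (h j)) -> spans g (\sum_j c j *: h j).
Proof.
move=> gh; elim/big_ind: _ => [|_ _ [d ->] [d' ->]|j _]; first exact: spans0.
  exists (fun i => d i + d' i); rewrite -big_split.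
  by apply: eq_bigr => i _; rewrite scalerDl.
exact/spansZ/gh.
Qed.

Lemma spans_mull (I J : finType) (g : I -> Q) (h : J -> Q) y x :
  (forall i, spans h (y * g i)) -> spans g x -> spans h (y * x).
Proof.
move=> hg [c ->]; rewrite mulr_sumr.
under eq_bigr => i _ do rewrite -scalerAr.
exact: spans_sum.
Qed.

Definition word (w : seq (letter n)) : Q := \prod_(A <- w) qs (val A).

(** Chains of other degrees are replaced by 0 instead of dropped, so that all degrees share one
    index set. *)
Definition chain_deg p (x : T) : Q := (#|x.2| == p)%:R *: chain x.

(** The monomial relations kill s(A) times a chain of A' unless A' = A \ b; in that case [qs_chain]
    gives, up to sign, the chain of A with b added to B. *)
Lemma spans_chain_qs A p x : A != set0 ->
  spans (chain_deg p) x -> spans (chain_deg p.+1) (qs A * x).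
Proof.
move=> A0; apply: spans_mull => -[A' B]; rewrite /chain_deg /= -scalerAr.
case: eqP => [cB|_]; last by rewrite scale0r; apply: spans0.
rewrite scale1r.
have [->|A'0] := eqVneq A' set0; first by rewrite chain_set0 mulr0; apply: spans0.
have [AA'|nAA'] := boolP ((A' \subset A) && (#|A'| == #|A| - 1)%N); last first.
  have [y ->] := chain_head A' B; rewrite mulrA qs_mul -?negb_and // mul0r.
  exact: spans0.
have [sA'A /eqP cA'] := andP AA'.
have [sBA'|/negbTE nBA'] := boolP (B \subset A'); last first.
  by rewrite /chain /= nBA' mulr0; apply: spans0.
have /cards1P[b bE] : #|A :\: A'| == 1%N.
  by rewrite cardsDS // cA' subKn // card_gt0.
have : b \in A :\: A' by rewrite bE set11.
rewrite inE => /andP[bA' bA].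
have bB : b \notin B by apply: contra bA' => /(subsetP sBA').
have A'E : A' = A :\ b.
  by rewrite -bE setDDr setDv set0U; apply/esym/setIidPr.
have BE : B = (b |: B) :\ b by rewrite setU1K.
rewrite A'E {1}BE qs_chain ?setU11 //; last first.
  by rewrite subUset sub1set bA (subset_trans sBA').
apply: spansZ; have := spans_gen (chain_deg p.+1) (A, b |: B).
by rewrite /chain_deg /= cardsU1 bB cB eqxx scale1r.
Qed.

Lemma spans_word_chain p (w : p.+1.-tuple (letter n)) :
  spans (chain_deg p) (word w).
Proof.
elim: p w => [|p IH] w; case/tupleP: w => A w; rewrite /word /= big_cons; last first.
  by apply: spans_chain_qs; [apply: (valP A) | apply: IH].
rewrite tuple0 big_nil mulr1 -chain0.
have := spans_gen (chain_deg 0) (val A, set0).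
by rewrite /chain_deg /= cards0 eqxx scale1r.
Qed.

Lemma spans_chain_word A B : B \subset A ->
  spans (fun w : #|B|.+1.-tuple (letter n) => word w) (chain (A, B)).
Proof.
have qsP d (A' : {set 'I_n}) x : spans (fun w : d.-tuple (letter n) => word w) x ->
    spans (fun w : d.+1.-tuple (letter n) => word w) (qs A' * x).
  have [->|A'0] := eqVneq A' set0; first by rewrite qs0 mul0r => _; apply: spans0.
  apply: spans_mull => w.
  have := spans_gen (fun w : d.+1.-tuple (letter n) => word w) [tuple of exist _ A' A'0 :: w].
  by rewrite /word /= big_cons.
move: A B; apply: chain_ind => [A|A B b sBA bB IH]; last first.
  rewrite (chainE sBA bB) (cardsD1 b B) bB; exact/spansZ/qsP.
rewrite cards0 chain0 -[qs A]mulr1; apply: qsP.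
have := spans_gen (fun w : 0.-tuple (letter n) => word w) [tuple].
by rewrite /word big_nil.
Qed.

Lemma spans_wordP p x : spans (fun w : p.+1.-tuple (letter n) => word w) x <->
  spans (chain_deg p) x.
Proof.
split=> -[c ->]; apply: spans_sum; [exact: spans_word_chain | case=> A B].
rewrite /chain_deg /=; case: eqP => [<-|_]; last by rewrite scale0r; apply: spans0.
rewrite scale1r; have [sBA|/negbTE nBA] := boolP (B \subset A).
  exact: spans_chain_word.
by rewrite chain_nsub //; apply: spans0.
Qed.

End Chains.

(** * Operators on pairs of sets *)

Section Operators.
Variables (k : fieldType) (n : nat) (s : 'S_n).
Local Notation sg := (@sg k n).
Local Notation T := ({set 'I_n} * {set 'I_n})%type.
Implicit Types (A B C : {set 'I_n}) (a b c : 'I_n) (V : lmodType k) (x y : T).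

(** Row (A, B) holds the coordinates of e_A /\ B. Matrices thus act on row vectors and products
    compose from left to right. *)
Definition wedge_ker : T -> T -> k :=
  kern (fun x a => [&& x.2 \subset x.1, a \in x.1 & a \notin x.2])
    (fun x a => sg a x.2) (fun x a => (x.1, a |: x.2)).

(* Contraction with the coordinate form of a chosen element of A: as this form
   takes the value 1 on e_A, it is a homotopy for e_A /\ _. *)
Definition contr_ker : T -> T -> k :=
  kern (fun x b => [&& x.2 \subset x.1, b \in x.2 & [pick a in x.1] == Some b])
    (fun x b => sg b (x.2 :\ b)) (fun x b => (x.1, x.2 :\ b)).

(** The projection onto the sum of the exterior algebras of k^A over nonempty A; for empty A the
    vector e_A is 0 and admits no homotopy. *)
Definition pair_ker : T -> T -> k :=
  monkern (fun x => ((x.1 != set0) && (x.2 \subset x.1))%:R) id.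

Definition deg_ker p : T -> T -> k := monkern (fun x => (#|x.2| == p)%:R) id.

Definition perm_ker : T -> T -> k :=
  monkern (fun x => inv_sign k s x.2) (fun x => (s @: x.1, s @: x.2)).

Definition x0 : T := (set0, set0).
Local Notation mx := (@kmx k _ x0).
Local Notation col := (@kcol k _ x0).

Lemma kmx2_col F G (u : T -> k) :
  mx F *m mx G *m col u = col (kact F (kact G (u : T -> k^o))).
Proof. by rewrite -mulmxA !kmx_col. Qed.

Lemma kcolD (u v : T -> k) : col u + col v = col (fun x => u x + v x).
Proof. by apply/matrixP => i j; rewrite !mxE. Qed.

Lemma kact_contr V (u : T -> V) A B a : [pick a in A] = Some a ->
  kact contr_ker u (A, B) =
  if (B \subset A) && (a \in B) then sg a (B :\ a) *: u (A, B :\ a) else 0.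
Proof.
move=> pA; rewrite kact_kern /= pA.
case: ifP => [/andP[sBA aB]|nB].
  rewrite (big_pred1 a) // => b; rewrite sBA /=.
  by apply/andP/eqP => [[_ /eqP[->]]|->]; rewrite ?aB ?eqxx.
by rewrite big_pred0 // => b; apply: contraFF nB => /and3P[-> bB /eqP[->]].
Qed.

Lemma kact_wedge V (u : T -> V) A B : B \subset A ->
  kact wedge_ker u (A, B) = \sum_(a in A :\: B) sg a B *: u (A, a |: B).
Proof.
move=> sBA; rewrite kact_kern; apply: eq_bigl => a.
by rewrite sBA /= inE andbC.
Qed.

Lemma kact_wedge_nsub V (u : T -> V) A B : (B \subset A) = false ->
  kact wedge_ker u (A, B) = 0.
Proof. by move=> nBA; rewrite kact_kern big_pred0 // => a; rewrite /= nBA. Qed.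

Lemma kact_pair V (u : T -> V) x :
  kact pair_ker u x = ((x.1 != set0) && (x.2 \subset x.1))%:R *: u x.
Proof. exact: kact_monkern. Qed.

Lemma kact_deg V p (u : T -> V) x : kact (deg_ker p) u x = (#|x.2| == p)%:R *: u x.
Proof. exact: kact_monkern. Qed.

Lemma kact_perm V (u : T -> V) x :
  kact perm_ker u x = inv_sign k s x.2 *: u (s @: x.1, s @: x.2).
Proof. exact: kact_monkern. Qed.

(** Contraction is an antiderivation with value 1 on e_A. If the chosen a is outside B, only adding
    and then removing a survives. If a is in B, removing and then adding a gives B back, and the
    terms that exchange a for some b cancel by [sg_swap]. *)
Lemma homotopy : mx wedge_ker *m mx contr_ker + mx contr_ker *m mx wedge_ker = mx pair_ker.
Proof.
apply: (eq_mx_kcol (x0 := x0)) => u.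
rewrite mulmxDl !kmx2_col kmx_col kcolD; apply: eq_kcol => -[A B].
rewrite kact_monkern /=.
have [sBA|/negbTE nBA] := boolP (B \subset A); last first.
  by rewrite !kact_kern !big_pred0 ?andbF ?scale0r ?addr0 // => b /=; rewrite nBA.
have [->|[a' a'A]] := set_0Vmem A.
  rewrite eqxx scale0r !kact_kern !big_pred0 ?addr0 // => b /=.
    by case: pickP => [c|_]; rewrite ?inE // !andbF.
  by rewrite inE !andbF.
have -> : A != set0 by apply/set0Pn; exists a'.
have [a pA] : exists a, [pick a in A] = Some a.
  by case: pickP => [a _|/(_ a')/=]; [exists a | rewrite a'A].
have aA : a \in A by case: pickP pA => // b bA [<-].
rewrite scale1r kact_wedge // (kact_contr _ _ pA) sBA /=.
under eq_bigr => b bD.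
  rewrite (kact_contr _ _ pA) subUset sub1set sBA andbT.
  have -> : b \in A by move: bD; rewrite inE => /andP[].
  over.
have [aB|aB] := boolP (a \in B); last first.
  rewrite addr0 (bigD1 a) ?inE ?aA ?aB //= eqxx setU1K // scalerA sg_sqr scale1r.
  rewrite big1 ?addr0 // => b /andP[_ /negbTE ba].
  by rewrite !inE eq_sym ba (negbTE aB) scaler0.
rewrite kact_wedge; last by apply: subset_trans sBA; apply: subsetDl.
have -> : A :\: (B :\ a) = a |: A :\: B.
  by apply/setP => b; rewrite !inE; case: (eqVneq b a) => [->|]; rewrite ?aA.
rewrite big_setU1 ?inE ?aB //= setD1K // scalerDr scalerA sg_sqr scale1r.
rewrite addrCA -[RHS]addr0; congr (_ + _); rewrite scaler_sumr.
rewrite -big_split big1 // => b; rewrite inE => /andP[bB bA] /=.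
have ba : b != a by apply: contraNneq bB => ->.
rewrite !inE aB orbT setU1D1 // !scalerA.
suff -> : sg b B * sg a (b |: B :\ a) = - (sg a (B :\ a) * sg b (B :\ a)).
  by rewrite scaleNr addNr.
have := @sg_swap k n b a (B :\ a) ba; rewrite setD1K // !inE eqxx (negbTE bB) andbF.
move=> /(_ isT isT) e1; have q2 := sg_sqr k a (b |: B :\ a).
rewrite -[sg b B]mulr1 -(sg_sqr k a (B :\ a)) [sg b B * _]mulrA e1.
by ring: q2.
Qed.

Lemma sub_imset_perm A B : (s @: B \subset s @: A) = (B \subset A).
Proof.
apply/idP/idP; last exact: imsetS.
move=> /subsetP sBA; apply/subsetP => b bB.
by rewrite -(mem_imset _ _ (@perm_inj _ s)) sBA // imset_f.
Qed.

(** As s maps e_A to e_(s A), the terms correspond under a |-> s a, with signs matched by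
    [inv_signU1]. *)
Lemma perm_wedge : mx perm_ker *m mx wedge_ker = mx wedge_ker *m mx perm_ker.
Proof.
apply: (eq_mx_kcol (x0 := x0)) => u.
rewrite ?kmx2_col ?kmx_col; apply: eq_kcol => -[A B].
rewrite kact_monkern !kact_kern /= scaler_sumr.
rewrite (reindex_inj (@perm_inj _ s)) /=; apply: eq_big => [a|a /and3P[_ aA aB]].
  rewrite !mem_imset; try exact: perm_inj.
  by rewrite sub_imset_perm.
have {}aB : a \notin B by move: aB; rewrite mem_imset //; apply: perm_inj.
rewrite kact_monkern /= imsetU1 inv_signU1 // !scalerA.
suff -> : sg a B * (inv_sign k s B * (sg a B * sg (s a) (s @: B))) =
  inv_sign k s B * sg (s a) (s @: B) by [].
by have q := sg_sqr k a B; ring: q.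
Qed.

Lemma deg_wedge p : mx (deg_ker p) *m mx wedge_ker = mx wedge_ker *m mx (deg_ker p.+1).
Proof.
apply: (eq_mx_kcol (x0 := x0)) => u.
rewrite ?kmx2_col ?kmx_col; apply: eq_kcol => -[A B].
rewrite kact_monkern !kact_kern /= scaler_sumr; apply: eq_bigr => a /and3P[_ aA aB].
by rewrite kact_monkern /= cardsU1 aB eqSS !scalerA mulrC.
Qed.

Lemma deg_contr p : mx (deg_ker p.+1) *m mx contr_ker = mx contr_ker *m mx (deg_ker p).
Proof.
apply: (eq_mx_kcol (x0 := x0)) => u.
rewrite ?kmx2_col ?kmx_col; apply: eq_kcol => -[A B].
rewrite kact_monkern !kact_kern /= scaler_sumr; apply: eq_bigr => a /and3P[_ aB _].
by rewrite kact_monkern /= (cardsD1 a B) aB eqSS !scalerA mulrC.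
Qed.

Lemma deg0_contr : mx (deg_ker 0) *m mx contr_ker = 0.
Proof.
apply: (eq_mx_kcol (x0 := x0)) => u; rewrite mul0mx.
transitivity (col (fun=> 0)); last by apply/matrixP => i j; rewrite !mxE.
rewrite ?kmx2_col ?kmx_col; apply: eq_kcol => -[A B].
rewrite kact_monkern kact_kern /= cards_eq0.
case: eqP => [->|_]; last by rewrite scale0r.
by rewrite big_pred0 ?scaler0 // => b; rewrite inE andbF.
Qed.

Lemma deg_deg p : mx (deg_ker p) *m mx (deg_ker p) = mx (deg_ker p).
Proof.
apply: (eq_mx_kcol (x0 := x0)) => u.
rewrite ?kmx2_col ?kmx_col; apply: eq_kcol => -[A B].
by rewrite !kact_monkern /=; case: eqP; rewrite ?scale1r ?scale0r.
Qed.

Lemma pair_wedge : mx pair_ker *m mx wedge_ker = mx wedge_ker.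
Proof.
apply: (eq_mx_kcol (x0 := x0)) => u.
rewrite ?kmx2_col ?kmx_col; apply: eq_kcol => -[A B].
rewrite kact_monkern kact_kern /=.
have [->|_] := eqVneq A set0; first by rewrite scale0r big_pred0 // => a; rewrite inE andbF.
by case: (B \subset A); rewrite ?scale1r // scale0r big_pred0.
Qed.

(** The product has at most one nonzero entry in each row, so only the pairs (A, B) fixed by s
    contribute to the trace. *)
Lemma tr_perm_deg_pair p :
  \tr (mx perm_ker *m (mx (deg_ker p) *m mx pair_ker)) =
  \sum_(A : {set 'I_n} | (s @: A == A) && (A != set0))
     \sum_(B : {set 'I_n} | (s @: B == B) && (B \subset A))
       inv_sign k s B * (#|B| == p)%:R.
Proof.
pose F x := inv_sign k s x.2 * ((#|x.2| == p)%:R * ((x.1 != set0) && (x.2 \subset x.1))%:R).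
have -> : mx perm_ker *m (mx (deg_ker p) *m mx pair_ker) =
    mx (monkern F (fun x => (s @: x.1, s @: x.2))).
  apply: (eq_mx_kcol (x0 := x0)) => u.
  rewrite -mulmxA kmx2_col !kmx_col; apply: eq_kcol => -[A B].
  rewrite !kact_monkern !scalerA /F /= sub_imset_perm -mulrA.
  rewrite (card_imset _ (@perm_inj _ s)).
  by rewrite -!card_gt0 (card_imset _ (@perm_inj _ s)).
rewrite tr_kmx.
rewrite (eq_bigr (fun x => F (x.1, x.2) * ((x.1, x.2) == (s @: x.1, s @: x.2))%:R)); last by case.
rewrite -(pair_bigA _ (fun A B => F (A, B) * ((A, B) == (s @: A, s @: B))%:R)) /=.
rewrite [RHS]big_mkcond; apply: eq_bigr => A _; rewrite [in RHS]big_mkcond /=.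
case: ifP => [/andP[/eqP sA A0]|nA].
  apply: eq_bigr => B _; rewrite /F /= xpair_eqE sA eqxx A0 /= [B == _]eq_sym.
  by case: (s @: B == B); case: (B \subset A); rewrite ?mulr1 ?mulr0.
rewrite big1 // => B _; rewrite /F xpair_eqE /= [A == s @: A]eq_sym.
by move: nA; case: (s @: A == A); rewrite ?mulr0 //= => ->; rewrite !mulr0 ?mul0r.
Qed.

End Operators.

(** * A representation detecting the relations of chains *)

Section Representation.
Variables (k : fieldType) (n : nat).
Local Notation sg := (@sg k n).
Local Notation T := ({set 'I_n} * {set 'I_n})%type.
Local Notation mx := (@kmx k _ (x0 n)).
Local Notation col := (@kcol k _ (x0 n)).
Local Notation wedge_ker := (@wedge_ker k n).
Implicit Types (A B C : {set 'I_n}) (a b c : 'I_n) (x y : T).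

(** Exchanging the indices shows S = - S, hence 2 S = 0. The characteristic enters here. *)
Lemma antisym_sum0 (V : lmodType k) (I : finType) (F : I -> I -> V) :
  2%:R != 0 :> k -> (forall i j, F i j = - F j i) -> \sum_i \sum_j F i j = 0.
Proof.
move=> k2 asF; set S := (X in X = _).
have SN : S = - S.
  rewrite {1}/S exchange_big -sumrN; apply: eq_bigr => i _; rewrite -sumrN.
  by apply: eq_bigr => j _.
have : 2%:R *: S = 0 by rewrite scaler_nat mulr2n {2}SN subrr.
by move/eqP; rewrite scaler_eq0 (negbTE k2) => /eqP.
Qed.

Lemma setD1_inj A a b : a \in A -> A :\ a = A :\ b -> a = b.
Proof.
by move=> aA /setP/(_ a); rewrite !inE eqxx aA !andbT => /esym/negbFE/eqP.
Qed.

(* s(A) maps (A \ a, eta) to (A, - a /\ eta) and kills the other summands. Then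
   chain (A, B) maps the vacuum - sum_A (A, 1) to (A, e_A /\ b_1 /\ ... /\ b_p) (see
   [rep_chain]), so every linear relation between chains is killed by e_A /\ _. *)
Definition rep_ker A : T -> T -> k :=
  kern (fun y a => [&& y.1 == A, a \in A & a \in y.2])
    (fun y a => - sg a (y.2 :\ a)) (fun y a => (A :\ a, y.2 :\ a)).

Definition vac : T -> k := fun x => - (x.2 == set0)%:R.

(** The image of s(B) lies in the summand of B, whereas s(A) is nonzero only on the summands of the
    sets A \ a. *)
Lemma rep_mul A B : ~~ (B \subset A) || (#|B| != #|A| - 1)%N ->
  mx (rep_ker A) *m mx (rep_ker B) = 0.
Proof.
move=> AB; apply: (eq_mx_kcol (x0 := x0 n)) => u; rewrite kmx2_col mul0mx.
transitivity (col (fun=> 0)); last by apply/matrixP => i j; rewrite !mxE.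
apply: eq_kcol => -[Y1 Y]; rewrite kact_kern big1 // => a /and3P[_ aA _].
rewrite kact_kern big_pred0 ?scaler0 // => b /=.
apply: contraTF AB => /and3P[/eqP <- _ _].
by rewrite subsetDl (cardsD1 a A) aA add1n subn1 /= eqxx.
Qed.

(** The composite sends (A \ {b, c}, eta) to the sum of b /\ c /\ eta over both orders of b and c,
    which is antisymmetric. *)
Lemma rep_sum A : 2%:R != 0 :> k ->
  mx (rep_ker A) *m (\sum_(a in A) mx (rep_ker (A :\ a))) = 0.
Proof.
move=> k2; apply: (eq_mx_kcol (x0 := x0 n)) => u; rewrite mul0mx.
rewrite mulmx_sumr mulmx_suml; under eq_bigr => a _ do rewrite kmx2_col.
apply/matrixP => i j; rewrite summxE mxE.
under eq_bigr => a _ do rewrite mxE kact_kern.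
case: (ev _ i) => Y1 Y /=.
have [_|_] := eqVneq Y1 A; last first.
  by rewrite big1 // => a _; rewrite big_pred0.
pose P b := (b \in A) && (b \in Y).
pose F b c : k^o := if [&& P b, P c & b != c] then
  (sg b (Y :\ b) * sg c (Y :\ b :\ c)) *: (u (A :\ b :\ c, Y :\ b :\ c) : k^o) else 0.
have asF b c : F b c = - F c b.
  rewrite /F [c == b]eq_sym [in RHS]andbCA.
  case: ifP => [/and3P[/andP[_ bY] /andP[_ cY] bc]|_]; last by rewrite oppr0.
  by rewrite sg_swapD // scaleNr ![_ :\ c :\ b]setD1C.
rewrite -[RHS](antisym_sum0 k2 asF) exchange_big [RHS]/=.
rewrite big_mkcond; apply: eq_bigr => b _ /=.
case: ifP => [/andP[bA bY]|nP]; last first.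
  by rewrite big1 // => c _; rewrite /F /P nP.
(* The rows of [rep_ker (A :\ a)] at A \ b vanish unless a = b. *)
rewrite (bigD1 b) //= [X in _ + X]big1 ?addr0 => [|a /andP[aA ab]]; last first.
  rewrite kact_kern big_pred0 ?scaler0 // => c /=; apply/negP => /and3P[/eqP E _ _].
  by case/eqP: ab; apply: (setD1_inj aA (esym E)).
rewrite kact_kern scaler_sumr big_mkcond; apply: eq_bigr => c _.
rewrite /F /P bA bY eqxx !inE [c == b]eq_sym.
case: (eqVneq b c) => [|_]; rewrite ?andbF // andbT.
by case: (c \in A); case: (c \in Y) => //=; rewrite scalerA mulrNN.
Qed.

Variables (Q : algType k) (qs : {set 'I_n} -> Q).
Hypothesis qs0 : qs set0 = 0.
Hypothesis qs_sum : forall A : {set 'I_n}, (2 <= #|A|)%N ->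
  qs A * \sum_(a in A) qs (A :\ a) = 0.
Hypothesis qs_mul : forall A B : {set 'I_n}, A != set0 -> B != set0 ->
  ~~ (B \subset A) || (#|B| != #|A| - 1)%N -> qs A * qs B = 0.
Variable H : {linear Q -> 'M[k]_(#|{: T}|.-1.+1)}.
Hypothesis H1 : H 1 = 1%:M.
Hypothesis HM : forall A (q : Q), H (qs A * q) = mx (rep_ker A) *m H q.

(** Put B' = B \ b. Then s(A) sends e_(A \ b) /\ B' to - b /\ e_(A \ b) /\ B' = e_A /\ b /\ B',
    because b /\ b = 0; this is why [rep_ker] carries a minus sign. In the base case it cancels the
    one in [vac]. *)
Lemma rep_chain A B : H (chain qs (A, B)) *m col vac = col (wedge_ker (A, B)).
Proof.
have [|/negbTE nBA] := boolP (B \subset A); last first.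
  rewrite chain_nsub // linear0 mul0mx; apply/matrixP => i j.
  by rewrite !mxE /wedge_ker /kern /= nBA big_pred0.
move: A B; apply: chain_ind => [A|A B b sBA bB IH].
  rewrite chain0 -[qs A]mulr1 HM H1 mulmx1 kmx_col; apply: eq_kcol => -[Y1 Y].
  rewrite kact_kern /wedge_ker /kern big_mkcond [RHS]big_mkcond; apply: eq_bigr => a _ /=.
  rewrite sub0set inE andbT sg0 mul1r xpair_eqE setU0 /vac /=.
  have [_|//] := eqVneq Y1 A; last by case: (a \in A).
  case: (a \in A) => //=; case: ifP => aY; last first.
    by case: eqP => // YE; move: aY; rewrite YE inE eqxx.
  have -> : (Y == [set a]) = (Y :\ a == set0).
    by rewrite -subset0 subDset setU0 eqEsubset sub1set aY andbT.
  case: eqP => [->|_]; last by rewrite oppr0 scaler0.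
  by rewrite sg0 scaleNr scale1r opprK.
rewrite (chainE qs0 qs_sum qs_mul sBA bB) linearZ /= HM -scalemxAl -mulmxA IH kmx_col.
transitivity (col (fun x => sg b (B :\ b) * kact (rep_ker A)
    (wedge_ker (A :\ b, B :\ b) : T -> k^o) x)).
  by apply/matrixP => i j; rewrite !mxE.
apply: eq_kcol => -[Y1 Y]; rewrite kact_kern /=.
have bA : b \in A := subsetP sBA b bB.
have [-> /=|nY1] := eqVneq Y1 A; last first.
  rewrite big_pred0 // mulr0 /wedge_ker /kern big1 // => c _.
  by rewrite xpair_eqE (negbTE nY1) mulr0.
rewrite big_mkcond (bigD1 b) //= bA big1 ?addr0 => [|a ab]; last first.
  case: ifP => // /andP[aA _]; rewrite /wedge_ker /kern big1 ?scaler0 // => c _.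
  rewrite xpair_eqE; case: eqP => [E|_]; last by rewrite mulr0.
  by rewrite (setD1_inj aA E) eqxx in ab.
rewrite /wedge_ker /kern; case: ifP => bY; last first.
  rewrite mulr0 big1 // => c _; rewrite xpair_eqE.
  by case: (Y =P _) bY => [->|]; rewrite ?andbF ?mulr0 // !inE bB orbT.
rewrite mulrA mulr_sumr; apply: eq_big => c.
  rewrite /= setSD // sBA !inE.
  by case: (eqVneq c b) => [->|]; rewrite ?bB ?andbF.
rewrite /= !inE => /and3P[_ /andP[cb cA] cB]; rewrite !xpair_eqE !eqxx /=.
have {}cB : c \notin B by move: cB; rewrite cb.
have -> : (Y :\ b == c |: B :\ b) = (Y == c |: B).
  rewrite -setU1D1 //; apply/eqP/eqP => [E|-> //].
  by rewrite -(setD1K bY) E setD1K // !inE bB orbT.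
case: eqP => [->|_]; last by rewrite !mulr0.
rewrite !mulr1 setU1D1 //.
have := @sg_swap k n c b (B :\ b) cb; rewrite setD1K // !inE eqxx (negbTE cB) andbF.
move=> /(_ isT isT) e1.
rewrite -[RHS]mulr1 -(sg_sqr k b (B :\ b)) [RHS]mulrA e1.
by ring.
Qed.

End Representation.

(** * The graded trace *)

Section ChainTrace.
Variables (k : fieldType) (n : nat) (s : 'S_n).
Local Notation T := ({set 'I_n} * {set 'I_n})%type.
Local Notation mx := (@kmx k _ (x0 n)).
Local Notation col := (@kcol k _ (x0 n)).
Local Notation ev := (@ev _ (x0 n)).
Implicit Types (A B C : {set 'I_n}).

Variables (Q : algType k) (qs : {set 'I_n} -> Q).
Hypothesis qs0 : qs set0 = 0.
Hypothesis qs_sum : forall A : {set 'I_n}, (2 <= #|A|)%N ->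
  qs A * \sum_(a in A) qs (A :\ a) = 0.
Hypothesis qs_mul : forall A B : {set 'I_n}, A != set0 -> B != set0 ->
  ~~ (B \subset A) || (#|B| != #|A| - 1)%N -> qs A * qs B = 0.
Variable H : {linear Q -> 'M[k]_(#|{: T}|.-1.+1)}.
Hypothesis H1 : H 1 = 1%:M.
Hypothesis HM : forall A (q : Q), H (qs A * q) = mx (rep_ker k A) *m H q.
Variable act : {linear Q -> Q}.
Hypothesis actM : {morph act : x y / x * y}.
Hypothesis act_qs : forall A, act (qs A) = qs (s @: A).

Local Notation E := (mx (@wedge_ker k n)).
Local Notation I := (mx (@contr_ker k n)).
Local Notation D := (mx (@pair_ker k n)).
Local Notation P p := (mx (@deg_ker k n p)).
Local Notation S := (mx (@perm_ker k n s)).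
Local Notation chain := (chain qs).

Lemma kact_wedge_chain x : kact (@wedge_ker k n) chain x = 0.
Proof.
case: x => A B; have [sBA|/negbTE nBA] := boolP (B \subset A).
  by rewrite kact_wedge // (chain_rel qs0 qs_sum qs_mul).
by rewrite kact_wedge_nsub.
Qed.

Lemma kact_pair_chain x : kact (@pair_ker k n) chain x = chain x.
Proof.
case: x => A B; rewrite kact_pair /=.
have [->|_] := eqVneq A set0; first by rewrite (chain_set0 qs0) scaler0.
by have [_|/negbTE nBA] := boolP (B \subset A); rewrite ?scale1r // chain_nsub ?scaler0.
Qed.

Lemma comb_chain_mul m (c : 'rV[k]_m) (M : 'M[k]_(m, _)) F :
  \sum_j (c *m (M *m mx F)) 0 j *: chain (ev j) =
  \sum_j (c *m M) 0 j *: kact F chain (ev j).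
Proof.
rewrite mulmxA -[LHS]lincomb_mul; apply: eq_bigr => j _.
by rewrite sum_kmx.
Qed.

(** Rows of E become columns on which the representation acts, hence the transpose. A vanishing
    combination c of chains thus satisfies c E = 0. *)
Lemma H_comb_chain (c : 'rV[k]_(#|{: T}|.-1.+1)) :
  H (\sum_j c 0 j *: chain (ev j)) *m col (vac k (n:=n)) = (c *m E)^T.
Proof.
rewrite linear_sum mulmx_suml; apply/matrixP => i j; rewrite summxE !mxE.
apply: eq_bigr => l _; rewrite linearZ /= -scalemxAl.
case El: (ev l) => [A B].
rewrite (rep_chain qs0 qs_sum qs_mul H1 HM) !mxE El.
by rewrite ord1.
Qed.

(** The rows of E are relations between chains by [chain_rel], and the representation shows that E
    kills every such relation. *)
Lemma wedge_wedge : E *m E = 0.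
Proof.
apply/row_matrixP => i; rewrite row_mul row0; apply: trmx_inj.
rewrite -H_comb_chain trmx0.
under eq_bigr => j _ do rewrite mxE.
by rewrite sum_kmx kact_wedge_chain linear0 mul0mx.
Qed.

(** Conversely, D fixes the family of chains and D = E I + I E; if c E I = 0, the combination is
    that of c I E, and E applied to the chains gives 0. *)
Lemma chain_relP (c : 'rV[k]_(#|{: T}|.-1.+1)) :
  \sum_j c 0 j *: chain (ev j) = 0 <-> c *m (E *m I) = 0.
Proof.
split=> [c0|cEI].
  rewrite mulmxA; suff -> : c *m E = 0 by rewrite mul0mx.
  by apply: trmx_inj; rewrite -H_comb_chain c0 linear0 mul0mx trmx0.
transitivity (\sum_j (c *m (1%:M *m D)) 0 j *: chain (ev j)).
  by rewrite comb_chain_mul mulmx1; apply: eq_bigr => j _; rewrite kact_pair_chain.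
rewrite mul1mx -homotopy mulmxDr cEI add0r comb_chain_mul.
by rewrite big1 // => j _; rewrite kact_wedge_chain scaler0.
Qed.

(** An instance of [trace_on_idem] with the idempotent P_p E I, whose left kernel consists of the
    relations between the chains of degree p. *)
Lemma trace_chain p W :
  (forall x, W x <-> spans (chain_deg qs p) x) ->
  trace_on act W = \tr (S *m (P p *m (E *m I))).
Proof.
move=> WE; apply: (@trace_on_idem _ _ _ act _ (fun i => chain_deg qs p (ev i))).
- move=> x; rewrite WE; split=> [[c ->]|[c ->]].
    exists (\row_i c (ev i)); rewrite -(sum_ev (x0 n)).
    by apply: eq_bigr => i _; rewrite mxE.
  exists (fun x => c 0 (rk (x0 n) x)); rewrite -(sum_ev (x0 n)).
  by apply: eq_bigr => i _; rewrite evK.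
- move=> i; rewrite sum_kmx; case: (ev i) => A B; rewrite kact_perm /chain_deg /=.
  rewrite linearZ /= (card_imset _ (@perm_inj _ s)) scalerA mulrC -scalerA.
  congr (_ *: _); have [sBA|/negbTE nBA] := boolP (B \subset A).
    by apply: (chain_morph qs0 qs_sum qs_mul) => // a x; rewrite linearZ.
  by rewrite !chain_nsub ?sub_imset_perm // linear0 scaler0.
(* E I E = (D - I E) E = E, since D E = E and E E = 0. *)
- have EIE : E *m I *m E = E.
    rewrite -(addrK (I *m E) (E *m I)) homotopy mulmxBl pair_wedge -mulmxA.
    by rewrite wedge_wedge mulmx0 subr0.
  have PEI : P p *m (E *m I) = E *m I *m P p.
    by rewrite mulmxA deg_wedge -!mulmxA deg_contr.
  rewrite {2}PEI -mulmxA [E *m I *m (_ *m _)]mulmxA [E *m I *m _]mulmxA EIE.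
  by rewrite -PEI mulmxA deg_deg.
move=> c; rewrite mulmxA -chain_relP.
have -> : \sum_i c 0 i *: chain_deg qs p (ev i) =
    \sum_j (c *m P p) 0 j *: chain (ev j); last by [].
rewrite -[P p]mul1mx comb_chain_mul mulmx1; apply: eq_bigr => j _.
by rewrite kact_deg.
Qed.

(** Cyclicity turns the trace of E I in degree p into that of I E in degree p + 1, and E I + I E =
    D. *)
Lemma trace_chain_rec p :
  \tr (S *m (P p.+1 *m (E *m I))) + \tr (S *m (P p *m (E *m I))) =
  \tr (S *m (P p.+1 *m D)).
Proof.
rewrite (mxtrace_shift I (perm_wedge k s) (deg_wedge k n p)).
by rewrite -mxtraceD -mulmxDr -mulmxDr homotopy.
Qed.

Lemma trace_chain0 : \tr (S *m (P 0 *m (E *m I))) = \tr (S *m (P 0 *m D)).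
Proof.
by rewrite -homotopy (mulmx_annihD E (deg0_contr k n)).
Qed.

(** The summand at p = 0 comes from the empty A, which D leaves out. *)
Lemma coef_prod_porbits p :
  (\prod_(C in porbits s) (2%:R - (- 'X) ^+ #|C|) : {poly k})`_p =
  (p == 0)%:R + \tr (S *m (P p *m D)).
Proof.
rewrite prod_porbits tr_perm_deg_pair coef_sum (bigD1 set0) ?imset0 //=.
congr (_ + _).
  rewrite (big_pred1 set0) => [|B]; last first.
    by rewrite subset0 /=; case: (eqVneq B set0) => [->|_]; rewrite ?andbF // imset0 eqxx.
  by rewrite inv_sign0 mul1r cards0 coefXn.
apply: eq_bigr => A _; rewrite coef_sum; apply: eq_bigr => B _.
by rewrite coefCM coefXn eq_sym.
Qed.

End ChainTrace.

(** * The representation of the quadratic dual and its component of degree 0 *)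

Section QdualTrace.
Variables (k : fieldType) (n : nat).
Local Notation T := ({set 'I_n} * {set 'I_n})%type.
Local Notation N := (#|{: T}|.-1.+1).
Local Notation mx := (@kmx k _ (x0 n)).

Definition rep_word (w : {fmonom letter n}) : 'M[k]_N :=
  \prod_(A <- w) mx (rep_ker k (val A)).

Lemma rep_word_mmorphism : mmorphism rep_word.
Proof.
by split=> [u v|]; rewrite /rep_word ?fm1 ?big_nil // fmM big_cat.
Qed.
HB.instance Definition _ :=
  isMultiplicative.Build {fmonom letter n} 'M[k]_N rep_word rep_word_mmorphism.

Definition rep_free (x : freeQ k n) : 'M[k]_N := mmap (in_alg 'M[k]_N) rep_word x.

Lemma rep_free_zmod_morphism : zmod_morphism rep_free.
Proof. exact: mmap_is_additive. Qed.
HB.instance Definition _ := GRing.isZmodMorphism.Build (freeQ k n) 'M[k]_N rep_free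
  rep_free_zmod_morphism.

Lemma rep_free_monoid_morphism : monoid_morphism rep_free.
Proof.
have [] := @commr_mmap_is_multiplicative _ _ _ (in_alg 'M[k]_N) rep_word.
  by move=> g w w'; rewrite /GRing.comm /= mulr_algl mulr_algr.
by [].
Qed.
HB.instance Definition _ := GRing.isMonoidMorphism.Build (freeQ k n) 'M[k]_N rep_free
  rep_free_monoid_morphism.

Lemma rep_freeZ : scalable rep_free.
Proof.
move=> c x; rewrite /rep_free.
by rewrite (@mmapZ _ _ _ (in_alg 'M[k]_N) rep_word) /= mulr_algl.
Qed.

Lemma rep_free_fs (A : {set 'I_n}) : rep_free (fs k A) = mx (rep_ker k A).
Proof.
rewrite /fs; case: insubP => [l _ <-|].
  by rewrite /rep_free mmapU /= scale1r mul1r /rep_word fmU big_seq1.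
rewrite negbK => /eqP->; rewrite raddf0; apply/matrixP => i j.
by rewrite !mxE /rep_ker /kern big_pred0 // => a; rewrite inE andbF.
Qed.

Lemma rep_free_ideal x : 2%:R != 0 :> k -> Qideal x -> rep_free x = 0.
Proof.
move=> k2; elim=> {x} [x [A A2|A B A0 B0 AB]||x y _ x0 _ y0|x y _ y0|x y _ x0].
- rewrite rmorphM rmorph_sum /= rep_free_fs.
  under eq_bigr => a _ do rewrite rep_free_fs.
  exact: rep_sum.
- by rewrite rmorphM /= !rep_free_fs; apply: rep_mul.
- exact: raddf0.
- by rewrite raddfD /= x0 y0 addr0.
- by rewrite rmorphM /= y0 mulr0.
- by rewrite rmorphM /= x0 mul0r.
Qed.

(* The argument k2 makes the linear structure below, which depends on it, inferable. *)
Definition rep (k2 : 2%:R != 0 :> k) (x : Qdual k n) : 'M[k]_N := rep_free (repr x).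

Section Char.
Variable k2 : 2%:R != 0 :> k.

Lemma rep_pi x : rep k2 (qpi x) = rep_free x.
Proof.
apply/eqP; rewrite -subr_eq0 /rep -raddfB; apply/eqP.
exact/rep_free_ideal/repr_qpi.
Qed.

Lemma rep_zmod_morphism : zmod_morphism (rep k2).
Proof.
by move=> x y; rewrite -[x]qpiK -[y]qpiK -raddfB !rep_pi raddfB.
Qed.
Lemma rep_scalable : scalable (rep k2).
Proof. by move=> c x; rewrite -[x]qpiK -linearZ !rep_pi rep_freeZ. Qed.

HB.instance Definition _ := GRing.isZmodMorphism.Build (Qdual k n) 'M[k]_N (rep k2)
  rep_zmod_morphism.
HB.instance Definition _ := GRing.isScalable.Build k (Qdual k n) 'M[k]_N *:%R (rep k2)
  rep_scalable.

Lemma rep1 : rep k2 1 = 1%:M.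
Proof. by rewrite -(rmorph1 (@qpi k n)) rep_pi rmorph1. Qed.

Lemma rep_qs (A : {set 'I_n}) q : rep k2 (qs k A * q) = mx (rep_ker k A) *m rep k2 q.
Proof. by rewrite -[q]qpiK -rmorphM !rep_pi rmorphM /= rep_free_fs. Qed.

End Char.

Lemma graded_trace0 (s : 'S_n) : @graded_trace k n s 0 = 1.
Proof.
rewrite /graded_trace (@trace_onE _ _ (@Qact k n s) _ 1 (fun=> 1) 1%:M) ?mxtrace1 //.
  split=> [_|c c0 i|x [c ->]].
  - exists (fun=> 1); rewrite (big_pred1 [tuple]) => [|w]; last by apply/esym/eqP; exact: tuple0.
    by rewrite /qword big_nil scale1r.
  - move: c0; rewrite big_ord1 => /eqP; rewrite scaler_eq0 oner_eq0 orbF.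
    by rewrite (ord1 i) => /eqP.
  exists (fun=> c [tuple]); rewrite big_ord1 (big_pred1 [tuple]) => [|w].
    by rewrite /qword big_nil.
  by apply/esym/eqP; exact: tuple0.
by move=> i; rewrite big_ord1 mxE !ord1 eqxx scale1r rmorph1.
Qed.

End QdualTrace.

Theorem theorem8p3 (k : fieldType) (chark0 : [pchar k] =i pred0)
    (n : nat) (sigma : 'S_n) :
  forall d : nat,
    @graded_trace k n sigma d =
    psdiv
      (psof (1 + 'X * \prod_(C in porbits sigma) (2%:R - (- 'X) ^+ #|C|)))
      (psof (1 + 'X)) d.
Proof.
have k2 : 2%:R != 0 :> k by have := chark0 2; rewrite !inE /= => ->.
set F := \prod_(C in _) _.
have fE p : psof (1 + 'X * F) p.+1 = F`_p.
  by rewrite /psof coefD coef1 add0r coefXM.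
pose mx := @kmx k _ (x0 n).
(* Words of length p + 1 correspond to wedges of degree p, as the first letter s(A) removes no
   element. *)
have trE p : @graded_trace k n sigma p.+1 = \tr (mx (perm_ker k sigma) *m
    (mx (deg_ker k (n:=n) p) *m (mx (@wedge_ker k n) *m mx (@contr_ker k n)))).
  rewrite /graded_trace.
  apply: (@trace_chain k n sigma _ (@qs k n) (@qs0 k n) (@qs_sum k n) (@qs_mul k n)
    _ (@rep1 k n k2) (@rep_qs k n k2) _ _ (@Qact_qs k n sigma)) => x.
    by move=> y; rewrite rmorphM.
  by rewrite -(spans_wordP (@qs0 k n) (@qs_sum k n) (@qs_mul k n)).
apply: psdiv_1X => [|d]; first by rewrite graded_trace0 /psof coefD coef1 coefXM addr0.
(* For d = 0 the trace 1 in degree 0 matches the contribution of the empty A to the constant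
   coefficient of F. *)
rewrite fE coef_prod_porbits; case: d => [|d].
  by rewrite trE graded_trace0 trace_chain0 addrC.
by rewrite !trE trace_chain_rec add0r.
Qed.
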